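(* Let $H$ be a graph that does not contain any of the graphs $C_4$, $C_6$, $C_8$, $C_3\oplus C_3$, $C_3\oplus C_5$, $C_3\oplus C_7$, $C_3\oplus P_2\oplus C_3$, and that contains two edge-disjoint $C_3$'s and contains $C_{10}$. Let $s_{33}$, $s_{35}$ and $s_{55}$ be the numbers of subgraphs of $H$ isomorphic to $C_3\oplus P_4\oplus C_3$, $C_3\oplus P_2\oplus C_5$ and $C_5\oplus C_5$, respectively. Then $H$ is locally common if and only if $4s_{33}s_{55}\ge (s_{35})^2$.
   Context: All graphs are finite and simple. ''Contains'' and ''subgraph'' refer to not necessarily induced subgraphs. $C_n$ is the $n$-vertex cycle and $P_n$ is the path with $n$ edges. $C_k\oplus C_\ell$ is the graph obtained by identifying one vertex of $C_k$ and one vertex of $C_\ell$; $C_k\oplus P_n\oplus C_\ell$ is obtained from the disjoint union of $C_k$, $P_n$ and $C_\ell$ by identifying one vertex of $C_k$ with one end-vertex of $P_n$ and one vertex of $C_\ell$ with the other end-vertex of $P_n$. A kernel is a bounded measurable symmetric function $U:[0,1]^2\to\mathbb R$, and for a graph $H$ one sets $t(H,U)=\int_{[0,1]^{V(H)}}\prod_{uv\in E(H)}U(x_u,x_v)\,dx_{V(H)}$; a real number $p$ also denotes the constant function $p$ on $[0,1]^2$. A graph $H$ is locally common if for every kernel $U$ there exists $\varepsilon_0>0$ such that $2t(H,1/2)\le t(H,1/2+\varepsilon U)+t(H,1/2-\varepsilon U)$ for every $\varepsilon\in(0,\varepsilon_0)$. *)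

(* Defs.v *)
From HB Require Import structures.
From mathcomp Require Import all_boot all_order all_algebra.
From mathcomp Require Import all_classical all_reals all_analysis.

Set Implicit Arguments.
Unset Strict Implicit.
Unset Printing Implicit Defensive.

Import Order.TTheory GRing.Theory Num.Theory.

Local Open Scope classical_set_scope.
Local Open Scope ring_scope.

Record sgraph := SGraph {
  vertex :> finType;
  edge : rel vertex;
  edge_sym : symmetric edge;
  edge_irrefl : irreflexive edge
}.

Section cycle_path.
Variable n : nat.

(* This is the n-vertex cycle only for n >= 3.  The vertex type is written
   with n.-1.+1 so that it is nonempty by construction, with a base point
   [ord0]; it is convertible to 'I_n for every numeral n > 0. *)
Definition cycle_rel : rel 'I_n.-1.+1 :=
  fun i j => (i != j) && ((j == ordS i) || (i == ordS j)).

Lemma cycle_rel_sym : symmetric cycle_rel.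
Proof. by move=> i j; rewrite /cycle_rel eq_sym orbC. Qed.

Lemma cycle_rel_irrefl : irreflexive cycle_rel.
Proof. by move=> i; rewrite /cycle_rel eqxx. Qed.

Definition cycle_graph : sgraph := SGraph cycle_rel_sym cycle_rel_irrefl.

(* n counts edges, so there are n.+1 vertices. *)
Definition path_rel : rel 'I_n.+1 :=
  fun i j => (j == i.+1 :> nat) || (i == j.+1 :> nat).

Lemma path_rel_sym : symmetric path_rel.
Proof. by move=> i j; rewrite /path_rel orbC. Qed.

Lemma path_rel_irrefl : irreflexive path_rel.
Proof. by move=> i; rewrite /path_rel orbb ltn_eqF. Qed.

Definition path_graph : sgraph := SGraph path_rel_sym path_rel_irrefl.

End cycle_path.

(* The disjoint union of G1 and G2 with v1 and v2 identified: the merged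
   vertex is represented by [inl v1], and v2 is removed from G2. *)
Section glue.
Variables (G1 : sgraph) (v1 : G1) (G2 : sgraph) (v2 : G2).

Definition glue_vertex : finType := (G1 + {y : G2 | y != v2})%type.

Definition glue_rel : rel glue_vertex := fun a b =>
  match a, b with
  | inl x, inl x' => edge x x'
  | inr y, inr y' => edge (val y) (val y')
  | inl x, inr y | inr y, inl x => (x == v1) && edge v2 (val y)
  end.

Lemma glue_rel_sym : symmetric glue_rel.
Proof. by move=> [x|y] [x'|y'] //=; exact: edge_sym. Qed.

Lemma glue_rel_irrefl : irreflexive glue_rel.
Proof. by move=> [x|y] /=; exact: edge_irrefl. Qed.

Definition glue : sgraph := SGraph glue_rel_sym glue_rel_irrefl.

Definition glue_inr (y : G2) : glue :=
  if insub y is Some y' then inr y' else inl v1.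

End glue.

Definition cycle_cycle (k l : nat) : sgraph :=
  @glue (cycle_graph k) ord0 (cycle_graph l) ord0.

Definition cycle_path_cycle (k n l : nat) : sgraph :=
  @glue (@glue (cycle_graph k) ord0 (path_graph n) ord0)
        (@glue_inr (cycle_graph k) ord0 (path_graph n) ord0 ord_max)
        (cycle_graph l) ord0.

Section subgraphs.
Variables H G : sgraph.

Definition edges : {set {set H}} :=
  [set A | [exists x : H, exists y : H, edge x y && (A == [set x; y]%SET)]]%SET.

(* A (not necessarily induced) subgraph is a set of vertices together with a
   set of edges whose ends are among them. *)
Definition is_subgraph (K : {set H} * {set {set H}}) : bool :=
  (K.2 \subset edges) && [forall A in K.2, A \subset K.1].

Definition is_iso_to (K : {set H} * {set {set H}}) : bool :=
  [exists f : {ffun G -> H},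
    [&& injectiveb f, [set f x | x : G]%SET == K.1 &
        [forall x : G, forall y : G, edge x y == ([set f x; f y]%SET \in K.2)]]].

Definition copies : {set {set H} * {set {set H}}} :=
  [set K | is_subgraph K && is_iso_to K]%SET.

Definition contains : Prop := exists K, K \in copies.

Definition contains_two_edge_disjoint : Prop :=
  exists K1 K2, [/\ K1 \in copies, K2 \in copies & K1.2 :&: K2.2 = finset.set0].

End subgraphs.

(* The n-fold product of a probability measure. *)
Section power_probability.
Context d (T : measurableType d) (R : realType) (P : probability T R).

Definition tuple_cons n (p : T * n.-tuple T) : n.+1.-tuple T :=
  [tuple of p.1 :: p.2].

Lemma measurable_tuple_cons n : measurable_fun [set: T * n.-tuple T] (@tuple_cons n).
Proof. exact: measurable_cons. Qed.

HB.instance Definition _ n :=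
  @isMeasurableFun.Build _ _ _ _ (@tuple_cons n) (@measurable_tuple_cons n).

Fixpoint power_prob (n : nat) : probability (n.-tuple T) R :=
  match n with
  | 0 => \d_([tuple] : 0.-tuple T)
  | m.+1 => distribution (P \x power_prob m)%E (@tuple_cons m)
  end.

Lemma power_prob_box n (A : 'I_n -> set T) : (forall i, measurable (A i)) ->
  power_prob n [set x | forall i, A i (tnth x i)] = (\prod_(i < n) P (A i))%E.
Proof.
elim: n A => [|n IHn] A mA.
  rewrite big_ord0 /= diracE mem_set//=.
  by case.
rewrite big_ord_recl -(IHn (fun i => A (lift ord0 i)))//=.
rewrite /distribution /pushforward -product_measure1E//; last first.
  rewrite [X in measurable X](_ : _ =
      \bigcap_(i in [set: 'I_n]) ((@tnth n T)^~ i @^-1` A (lift ord0 i))).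
    apply: fin_bigcap_measurable => // i _.
    by rewrite -[X in measurable X]setTI; exact: measurable_tnth.
  apply/seteqP; split => x /= h i => [_|]; first exact: (h i).
  exact: (h i I).
congr (_ _); apply/seteqP; split => [[a x] /= h|[a x] /= [h0 h] i].
  split; first exact: (h ord0).
  by move=> i; have := h (lift ord0 i); rewrite tnthS.
by have [j ->|->//] := unliftP ord0 i; rewrite tnthS.
Qed.

End power_probability.

Section kernels.
Variable R : realType.

Local Notation I := (`[0, 1]%classic : set R).

Definition lebesgue01 : probability _ R := @uniform_prob R 0 1 ltr01.

Lemma lebesgue01E (A : set R) : measurable A ->
  lebesgue01 A = lebesgue_measure (A `&` I).
Proof.
move=> mA; rewrite /= /uniform_prob integral_uniform_pdf.
rewrite (eq_integral (cst 1%E)) ?integral_cst ?mul1e//; first exact: measurableI.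
move=> x; rewrite inE /= in_itv/= => -[_ xI].
by rewrite /uniform_pdf xI subr0 invr1.
Qed.

(* Functions on [0,1]^2 are represented by functions on R^2, whose values
   outside of [0,1]^2 are irrelevant throughout. *)
Definition is_kernel (U : R -> R -> R) : Prop :=
  [/\ measurable_fun (I `*` I) (fun p : R * R => U p.1 p.2),
      exists M, forall x y, I x -> I y -> `|U x y| <= M
    & forall x y, I x -> I y -> U x y = U y x].

(* The vertex u of H is assigned the coordinate [enum_rank u], and each edge
   contributes once, through its orientation by increasing rank. *)
Definition hom_density (H : sgraph) (U : R -> R -> R) : R :=
  \int[power_prob lebesgue01 #|H|]_(x in [set x | forall i, I (tnth x i)])
    \prod_(e : H * H | edge e.1 e.2 && (enum_rank e.1 < enum_rank e.2)%N)
      U (tnth x (enum_rank e.1)) (tnth x (enum_rank e.2)).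

Definition locally_common (H : sgraph) : Prop :=
  forall U, is_kernel U -> exists2 eps0 : R, 0 < eps0 &
    forall eps, 0 < eps < eps0 ->
      2 * hom_density H (fun _ _ => 2^-1) <=
        hom_density H (fun x y => 2^-1 + eps * U x y) +
        hom_density H (fun x y => 2^-1 - eps * U x y).

End kernels.

(* Main.v *)
From HB Require Import structures.
From mathcomp Require Import all_boot all_order all_algebra.
From mathcomp Require Import all_classical all_reals all_analysis.
From mathcomp Require Import measurable_realfun zify ring lra.
Require Import Defs.

(** Expanding the product over the edges of [H], the sum of the densities of
[1/2 + e U] and [1/2 - e U] exceeds twice the density of [1/2] by a sum over
the nonempty edge sets [F] of even size: the term of [F] is a positive multiple
of [e ^ #|F| * t(F, U)].  For small [e] the sign is that of the lowest nonzero
coefficient ([commonality_gap], [lowest_level]), so the sizes 2, 4, 6, 8, 10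
are examined in turn.

Let [T] be the integral operator of [U].  Size 2 gives a positive coefficient
unless the degree function [T 1] is zero ([level2_gt0]).  If it is zero, then
[t(F, U) = 0] for every [F] with a vertex of degree one ([dens_pendant]), and
only edge sets of minimum degree two count.  In [H], cycles of length 4, 6 and
8 are missing, so such sets of at most ten edges consist of odd cycles and
bridges, or are decagons.  An exhaustive search over edge lists, run as a
computation ([search_sound], [search10]), shows that nothing has 4 edges; with 6
edges there are only pairs of disjoint triangles, which contribute the square
of the triangle density [t3]; once [t3 = 0], nothing is left with 8 edges; and
with 10 edges the sets that count are [C3 + P4 + C3], [C3 + P2 + C5], [C5 + C5]
joined as in the theorem, decagons, and pairs of disjoint pentagons.

Let [f] and [g] be the densities of triangles and pentagons at a point.
Self-adjointness of [T] turns the tenth coefficient into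
[s33 |T^2 f|^2 + s35 (T^2 f, g) + s55 |g|^2], plus a nonnegative multiple of the
squared pentagon density, plus a positive multiple of the decagon density
[|T^5|^2] ([pat_dens_cpc343], [pat_dens_cpc325], [pat_dens_cc55], [level10]).
If [4 s33 s55 >= s35^2], the quadratic form is nonnegative by Cauchy-Schwarz,
so the coefficient is positive unless the decagon density is zero; in that case
[T] is zero ([cycle_density_null]) and so are all densities ([dens_null]).

If [4 s33 s55 < s35^2], the form is negative for some pair of values with
opposite signs, and [test_kernel] is a kernel of finite rank with [T 1 = 0] and
[t3 = 0] in which [T^2 f] and [g] are constant multiples of one function, in
such a ratio, while the form dominates the decagon density
([negative_parameters]).  The same kernel gives different densities to the
three shapes, which shows that they are counted separately
([disjoint_shapes]). *)

Set Implicit Arguments.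
Unset Strict Implicit.
Unset Printing Implicit Defensive.

Import Order.TTheory GRing.Theory Num.Theory.
Import numFieldNormedType.Exports.

Local Open Scope classical_set_scope.
Local Open Scope ring_scope.

(** * Bounded measurable functions and their integrals *)

Section bounded_measurable.
Context {R : realType}.

Definition bmfun d (X : measurableType d) (f : X -> R) : Prop :=
  measurable_fun [set: X] f /\ exists M : R, forall x, `|f x| <= M.

Section closure.
Context d (X : measurableType d).
Implicit Types f g : X -> R.

Lemma eq_bmfun f g : f =1 g -> bmfun f -> bmfun g.
Proof. by move=> /funext ->. Qed.

Lemma bmfun_cst c : bmfun (fun _ : X => c).
Proof. by split; [exact: measurable_cst|exists `|c|]. Qed.

Lemma bmfunD f g : bmfun f -> bmfun g -> bmfun (fun x => f x + g x).
Proof.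
move=> [mf [M fM]] [mg [N gN]]; split; first exact: measurable_funD.
by exists (M + N) => x; rewrite (le_trans (ler_normD _ _))// lerD.
Qed.

Lemma bmfunM f g : bmfun f -> bmfun g -> bmfun (fun x => f x * g x).
Proof.
move=> [mf [M fM]] [mg [N gN]]; split; first exact: measurable_funM.
by exists (M * N) => x; rewrite normrM ler_pM.
Qed.

Lemma bmfunZ c f : bmfun f -> bmfun (fun x => c * f x).
Proof. by move=> bf; apply: bmfunM => //; exact: bmfun_cst. Qed.

Lemma bmfun_sum I (r : seq I) (Q : pred I) (F : I -> X -> R) :
  (forall i, Q i -> bmfun (F i)) -> bmfun (fun x => \sum_(i <- r | Q i) F i x).
Proof.
move=> bF; elim: r => [|i r IHr].
  by apply: (eq_bmfun _ (bmfun_cst _)) => x; rewrite big_nil.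
have [Qi|Qi] := boolP (Q i); last first.
  by apply: eq_bmfun IHr => x; rewrite big_cons (negPf Qi).
by apply: (eq_bmfun _ (bmfunD (bF i Qi) IHr)) => x; rewrite big_cons Qi.
Qed.

Lemma bmfun_prod I (r : seq I) (Q : pred I) (F : I -> X -> R) :
  (forall i, Q i -> bmfun (F i)) -> bmfun (fun x => \prod_(i <- r | Q i) F i x).
Proof.
move=> bF; elim: r => [|i r IHr].
  by apply: (eq_bmfun _ (bmfun_cst _)) => x; rewrite big_nil.
have [Qi|Qi] := boolP (Q i); last first.
  by apply: eq_bmfun IHr => x; rewrite big_cons (negPf Qi).
by apply: (eq_bmfun _ (bmfunM (bF i Qi) IHr)) => x; rewrite big_cons Qi.
Qed.

Lemma bmfun_comp d' (Y : measurableType d') (h : Y -> X) f :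
  measurable_fun [set: Y] h -> bmfun f -> bmfun (fun y => f (h y)).
Proof.
move=> mh [mf [M fM]]; split; first exact: measurableT_comp.
by exists M => y.
Qed.

End closure.

Section integral.
Context d (X : measurableType d) (mu : probability X R).
Implicit Types f g : X -> R.

Lemma bmfun_integrable f : bmfun f -> mu.-integrable [set: X] (EFin \o f).
Proof.
move=> [mf [M fM]]; apply: measurable_bounded_integrable => //.
  by rewrite -ge0_fin_numE// fin_num_measure.
exists M; split; first exact: num_real.
by move=> N MN x _ /=; rewrite (le_trans (fM x))// ltW.
Qed.

Lemma eq_Rint f g : f =1 g -> \int[mu]_x f x = \int[mu]_x g x.
Proof. by move=> /funext ->. Qed.

Lemma Rint_cst c : \int[mu]_x (fun _ => c) x = c.
Proof.
rewrite Rintegral_cst// (_ : fine _ = 1) ?mulr1//.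
exact: (congr1 fine (probability_setT mu)).
Qed.

Lemma RintD f g : bmfun f -> bmfun g ->
  \int[mu]_x (f x + g x) = \int[mu]_x f x + \int[mu]_x g x.
Proof. by move=> bf bg; apply: RintegralD => //; exact: bmfun_integrable. Qed.

Lemma RintZ c f : bmfun f -> \int[mu]_x (c * f x) = c * \int[mu]_x f x.
Proof. by move=> bf; apply: RintegralZl => //; exact: bmfun_integrable. Qed.

Lemma Rint_sum I (r : seq I) (Q : pred I) (F : I -> X -> R) :
  (forall i, Q i -> bmfun (F i)) ->
  \int[mu]_x (\sum_(i <- r | Q i) F i x) =
  \sum_(i <- r | Q i) \int[mu]_x F i x.
Proof.
move=> bF; elim: r => [|i r IHr].
  by rewrite big_nil -[RHS]Rint_cst; apply: eq_Rint => x; rewrite big_nil.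
rewrite big_cons; under [LHS]eq_Rint do rewrite big_cons.
case: ifPn => // Qi; rewrite RintD ?IHr//; first exact: bF.
exact: bmfun_sum.
Qed.

Lemma Rint_ge0 f : (forall x, 0 <= f x) -> 0 <= \int[mu]_x f x.
Proof. by move=> f0; exact: Rintegral_ge0. Qed.

Lemma le_Rint f g : bmfun f -> bmfun g -> (forall x, f x <= g x) ->
  \int[mu]_x f x <= \int[mu]_x g x.
Proof.
by move=> bf bg fg; apply: le_Rintegral => //; exact: bmfun_integrable.
Qed.

Lemma le_normr_Rint f : bmfun f -> `|\int[mu]_x f x| <= \int[mu]_x `|f x|.
Proof. by move=> bf; apply: le_normr_Rintegral => //; exact: bmfun_integrable. Qed.

End integral.

Section fubini.
Context d1 d2 (X : measurableType d1) (Y : measurableType d2).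
Variables (P : probability X R) (Q : probability Y R).
Variable f : X * Y -> R.
Hypothesis bf : bmfun f.

Lemma bmfun_sectionl y : bmfun (fun x => f (x, y)).
Proof.
by apply: (@bmfun_comp _ _ _ _ (fun x => (x, y)) f) => //; exact: pair2_measurable.
Qed.

Lemma bmfun_sectionr x : bmfun (fun y => f (x, y)).
Proof.
by apply: (@bmfun_comp _ _ _ _ (fun y => (x, y)) f) => //; exact: pair1_measurable.
Qed.

Let integrable_f : (P \x Q)%E.-integrable [set: X * Y] (EFin \o f).
Proof. exact: (@bmfun_integrable _ _ (P \x Q)%E). Qed.

Lemma bmfun_Rintr : bmfun (fun x => \int[Q]_y f (x, y)).
Proof.
split.
  apply: measurableT_comp; first exact: fine_measurable.
  exact: (measurable_fubini_F integrable_f).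
have [mf [M fM]] := bf.
exists M => x; have bx := bmfun_sectionr x.
rewrite (le_trans (le_normr_Rint _ bx))// -[leRHS](Rint_cst Q).
apply: le_Rint => //; last exact: bmfun_cst.
by split; [apply: measurableT_comp => //; case: bx
  | exists M => y; rewrite normr_id].
Qed.

Lemma bmfun_Rintl : bmfun (fun y => \int[P]_x f (x, y)).
Proof.
split.
  apply: measurableT_comp; first exact: fine_measurable.
  exact: (measurable_fubini_G integrable_f).
have [mf [M fM]] := bf.
exists M => y; have bx := bmfun_sectionl y.
rewrite (le_trans (le_normr_Rint _ bx))// -[leRHS](Rint_cst P).
apply: le_Rint => //; last exact: bmfun_cst.
by split; [apply: measurableT_comp => //; case: bx
  | exists M => x; rewrite normr_id].
Qed.

Lemma Rint_prod : \int[(P \x Q)%E]_z f z = \int[P]_x \int[Q]_y f (x, y).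
Proof.
rewrite /Rintegral -(integral12_prod_meas1 integrable_f); congr fine.
apply: eq_integral => x _; rewrite /fubini_F fineK//.
by apply: integrable_fin_num => //; exact: (bmfun_integrable Q (bmfun_sectionr x)).
Qed.

Lemma Rint_swap :
  \int[P]_x \int[Q]_y f (x, y) = \int[Q]_y \int[P]_x f (x, y).
Proof.
rewrite -Rint_prod /Rintegral -(integral21_prod_meas1 integrable_f); congr fine.
apply: eq_integral => y _; rewrite /fubini_G fineK//.
by apply: integrable_fin_num => //; exact: (bmfun_integrable P (bmfun_sectionl y)).
Qed.

End fubini.

End bounded_measurable.

(** * Integration over independent points *)

Section power.
Context {R : realType} d (T : measurableType d) (P : probability T R).

Definition boxes n : set (set (n.-tuple T)) :=
  [set B | exists2 A : 'I_n -> set T, (forall i, measurable (A i)) &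
     B = [set x | forall i, A i (tnth x i)]].

Lemma measurable_box n (A : 'I_n -> set T) : (forall i, measurable (A i)) ->
  measurable [set x : n.-tuple T | forall i, A i (tnth x i)].
Proof.
move=> mA; rewrite [X in measurable X](_ : _ =
  \bigcap_(i in [set: 'I_n]) ((@tnth n T)^~ i @^-1` A i)); last first.
  by apply/seteqP; split => x /= h i => [_|]; [exact: (h i)|exact: (h i I)].
apply: fin_bigcap_measurable => // i _.
by rewrite -[X in measurable X]setTI; exact: measurable_tnth.
Qed.

Lemma measurable_tuple_boxes n : @measurable _ (n.-tuple T) = <<s @boxes n >>.
Proof.
apply/seteqP; split; last first.
  apply: smallest_sub; first exact: sigma_algebra_measurable.
  by move=> _ [A mA ->]; exact: measurable_box.
apply: smallest_sub; first exact: smallest_sigma_algebra.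
rewrite -bigcup_seq; apply: bigcup_sub => i _ _ [B mB <-].
apply: sub_sigma_algebra.
exists (fun j => if j == i then B else setT); first by move=> j; case: ifP.
rewrite setTI; apply/seteqP; split => x /= => [Bx j|/(_ i)]; last by rewrite eqxx.
by case: eqP => // ->.
Qed.

(** Boxes are stable under intersection and generate the product
sigma-algebra. *)
Lemma power_prob_unique n (mu : {measure set (n.-tuple T) -> \bar R}) :
  (forall A : 'I_n -> set T, (forall i, measurable (A i)) ->
     mu [set x | forall i, A i (tnth x i)] = (\prod_(i < n) P (A i))%E) ->
  forall B, measurable B -> mu B = power_prob P n B.
Proof.
move=> muE B mB.
apply: (measure_unique (@boxes n) (fun _ => setT)) => //.
- exact: measurable_tuple_boxes.
- move=> _ _ [A mA ->] [A' mA' ->].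
  exists (fun i => A i `&` A' i); first by move=> i; exact: measurableI.
  apply/seteqP; split => x /= => [[h h'] i|h]; first by split.
  by split => i; have [] := h i.
- by move=> _; exists (fun _ => setT) => //; apply/seteqP; split.
- by apply/seteqP; split => // x _; exists 0%N.
- by move=> _ [A mA ->]; rewrite muE//; apply/esym; exact: power_prob_box.
- move=> _; have -> : mu setT = 1%E.
    rewrite (_ : setT = [set x : n.-tuple T | forall i, setT (tnth x i)]).
      rewrite (muE (fun _ => setT))// big1// => i _; exact: probability_setT.
    by apply/seteqP; split.
  exact: ltry.
Qed.

Section marginal.
Variables (m n : nat) (f : 'I_m -> 'I_n).
Hypothesis f_inj : injective f.

Definition coords (t : n.-tuple T) : m.-tuple T := [tuple tnth t (f i) | i < m].

Lemma measurable_coords : measurable_fun [set: n.-tuple T] coords.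
Proof.
apply/measurable_fun_tnthP => i.
rewrite (_ : _ \o _ = (fun t => tnth t (f i))); first exact: measurable_tnth.
by apply/funext => t /=; rewrite tnth_mktuple.
Qed.

(** Integrating a function of some of the coordinates over all of them is the
same as integrating over these coordinates only. *)
Lemma Rint_coords (g : m.-tuple T -> R) : bmfun g ->
  \int[power_prob P n]_t g (coords t) = \int[power_prob P m]_t g t.
Proof.
move=> bg.
pose mf := HB.pack coords (isMeasurableFun.Build _ _ _ _ _ measurable_coords)
  : {mfun n.-tuple T >-> m.-tuple T}.
have bgc : bmfun (g \o mf) by exact: bmfun_comp measurable_coords bg.
rewrite /Rintegral; congr fine.
rewrite -(@integral_distribution _ _ _ _ _ (power_prob P n) mf (EFin \o g)); last 2 first.
- by apply/measurable_EFinP; case: bg.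
- exact: (bmfun_integrable _ bgc).
apply: eq_measure_integral => B mB _.
apply: (power_prob_unique (mu := distribution (power_prob P n) mf)) => // A mA.
pose A' (j : 'I_n) : set T := if [pick i | f i == j] is Some i then A i else setT.
have mA' j : measurable (A' j) by rewrite /A'; case: pickP.
have A'f i : A' (f i) = A i.
  rewrite /A'; case: pickP => [i' /eqP/f_inj -> //|/(_ i)]; by rewrite eqxx.
transitivity (power_prob P n [set t | forall j, A' j (tnth t j)]).
  congr (power_prob P n _); apply/seteqP; split => t /= h => [j|i].
    rewrite /A'; case: pickP => // i /eqP <-.
    by have := h i; rewrite tnth_mktuple.
  by rewrite tnth_mktuple -A'f.
transitivity (\prod_(j < n) P (A' j))%E; first exact: power_prob_box.
rewrite (bigID [in codom f])/= [X in (_ * X)%E]big1 ?mule1; last first.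
  move=> j jf; rewrite /A'; case: pickP => [i /eqP fij|_]; last first. 
    exact: probability_setT.
  by case/negP: jf; rewrite -fij; exact: codom_f.
rewrite (eq_bigl [in [set f i | i in [set: 'I_m]]%SET])/=; last first.
  move=> j; apply/codomP/imsetP => [[i ->]|[i _ ->]]; last by exists i.
  by exists i; rewrite ?inE.
rewrite big_imset/=; last by move=> i j _ _ /f_inj.
by apply: eq_big => i; [rewrite inE|rewrite A'f].
Qed.

End marginal.
End power.

Section expectation.
Context {R : realType} d (T : measurableType d) (P : probability T R).

Definition Ex n (Phi : seq T -> R) : R := \int[power_prob P n]_t Phi t.

Definition bmseq n (Phi : seq T -> R) : Prop :=
  bmfun (fun t : n.-tuple T => Phi t).

Lemma eq_Ex n (Phi Psi : seq T -> R) :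
  (forall s, size s = n -> Phi s = Psi s) -> Ex n Phi = Ex n Psi.
Proof. by move=> e; apply: eq_Rint => t; rewrite e ?size_tuple. Qed.

Lemma eq_bmseq n (Phi Psi : seq T -> R) :
  (forall s, size s = n -> Phi s = Psi s) -> bmseq n Phi -> bmseq n Psi.
Proof. by move=> e; apply: eq_bmfun => t; rewrite e ?size_tuple. Qed.

Lemma Ex_cst n c : Ex n (fun _ => c) = c.
Proof. exact: (Rint_cst (power_prob P n)). Qed.

Lemma ExZ n c Phi : bmseq n Phi -> Ex n (fun s => c * Phi s) = c * Ex n Phi.
Proof. by move=> b; apply: RintZ. Qed.

Section cons.
Variables (n : nat) (Phi : seq T -> R).
Hypothesis b : bmseq n.+1 Phi.

Let bc : bmfun (fun p : T * n.-tuple T => Phi (p.1 :: p.2)).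
Proof. exact: (bmfun_comp (@measurable_tuple_cons _ T n) b). Qed.

Lemma bmseq_cons x : bmseq n (fun s => Phi (x :: s)).
Proof. exact: (bmfun_sectionr bc). Qed.

Lemma bmfun_cons s : size s = n -> bmfun (fun x => Phi (x :: s)).
Proof.
by move=> /eqP sn; exact: (bmfun_sectionl bc (Tuple sn)).
Qed.

Lemma bmfun_Ex_cons : bmfun (fun x => Ex n (fun s => Phi (x :: s))).
Proof. exact: (bmfun_Rintr P (power_prob P n) bc). Qed.

Lemma bmseq_Rint_cons : bmseq n (fun s => \int[P]_x Phi (x :: s)).
Proof. exact: (bmfun_Rintl P (power_prob P n) bc). Qed.

Lemma Ex_prod :
  Ex n.+1 Phi = \int[(P \x power_prob P n)%E]_p Phi (p.1 :: p.2).
Proof.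
rewrite /Ex /Rintegral; congr fine.
rewrite (@integral_distribution _ _ _ _ _ (P \x power_prob P n)%E _
  (fun t : n.+1.-tuple T => (Phi t)%:E)) //.
- by apply/measurable_EFinP; case: b.
- exact: (@bmfun_integrable _ _ _ (P \x power_prob P n)%E _ bc).
Qed.

Lemma Ex_S : Ex n.+1 Phi = \int[P]_x Ex n (fun s => Phi (x :: s)).
Proof. by rewrite Ex_prod (Rint_prod P (power_prob P n) bc). Qed.

Lemma Ex_S_swap : Ex n.+1 Phi = Ex n (fun s => \int[P]_x Phi (x :: s)).
Proof. by rewrite Ex_S (Rint_swap P (power_prob P n) bc). Qed.

End cons.

Lemma bmseq_nth2 x0 n i j : (i < n)%N -> (j < n)%N -> forall U : T -> T -> R,
  bmfun (fun p : T * T => U p.1 p.2) ->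
  bmseq n (fun s => U (nth x0 s i) (nth x0 s j)).
Proof.
move=> ilt jlt U bU.
apply: (@eq_bmfun _ _ _ (fun t : n.-tuple T =>
    U (tnth t (Ordinal ilt)) (tnth t (Ordinal jlt)))).
  by move=> t; rewrite !(tnth_nth x0).
apply: (@bmfun_comp _ _ _ _ _
    (fun t => (tnth t (Ordinal ilt), tnth t (Ordinal jlt))) _ _ bU).
by apply: measurable_fun_pair; exact: measurable_tnth.
Qed.

(** Independent points indexed by a finite type, in the order of its
enumeration. *)
Definition ExV (V : finType) (Phi : (V -> T) -> R) : R :=
  \int[power_prob P #|V|]_t Phi (fun v => tnth t (enum_rank v)).

Definition bmV (V : finType) (Phi : (V -> T) -> R) : Prop :=
  bmfun (fun t : #|V|.-tuple T => Phi (fun v => tnth t (enum_rank v))).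

Lemma ExV_map (V : finType) (vs : seq V) (Phi : seq T -> R) :
  uniq vs -> bmseq (size vs) Phi ->
  ExV (fun x : V -> T => Phi (map x vs)) = Ex (size vs) Phi.
Proof.
move=> uvs b.
pose f (i : 'I_(size vs)) := enum_rank (tnth (in_tuple vs) i).
have f_inj : injective f.
  move=> i j /enum_rank_inj; case: vs uvs b @f i j => [|v vs] uvs b f i j.
    by case: i.
  rewrite !(tnth_nth v) => /eqP; rewrite nth_uniq// => /eqP ij.
  exact: val_inj.
rewrite /Ex -(Rint_coords P f_inj b); apply: eq_Rint => t; congr Phi.
rewrite /= -[in LHS](in_tupleE vs) -[in LHS](map_tnth_enum (in_tuple vs)) -map_comp.
by [].
Qed.

End expectation.

(** * The integral operator of a kernel *)

Section inner_product.
Context {R : realType} d (T : measurableType d) (P : probability T R).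
Implicit Types f g h : T -> R.

Definition inner f g : R := \int[P]_x (f x * g x).

Lemma innerC f g : inner f g = inner g f.
Proof. by apply: eq_Rint => x; rewrite mulrC. Qed.

Lemma inner_ge0 f : 0 <= inner f f.
Proof. by apply: Rint_ge0 => x; rewrite -expr2 sqr_ge0. Qed.

Lemma inner_comb f g a b : bmfun f -> bmfun g ->
  inner (fun x => a * f x + b * g x) (fun x => a * f x + b * g x) =
  a ^+ 2 * inner f f + 2 * a * b * inner f g + b ^+ 2 * inner g g.
Proof.
move=> bf bg.
have bff := bmfunM bf bf; have bfg := bmfunM bf bg; have bgg := bmfunM bg bg.
transitivity (\int[P]_x (a ^+ 2 * (f x * f x) +
    (2 * a * b * (f x * g x) + b ^+ 2 * (g x * g x)))).
  by apply: eq_Rint => x; ring.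
rewrite RintD ?RintD ?RintZ//; last 4 first.
- exact: bmfunZ.
- exact: bmfunZ.
- exact: bmfunZ.
- by apply: bmfunD; exact: bmfunZ.
by rewrite addrA.
Qed.

Lemma inner_CS f g : bmfun f -> bmfun g ->
  inner f g ^+ 2 <= inner f f * inner g g.
Proof.
move=> bf bg.
have pos a b : 0 <= a ^+ 2 * inner f f + 2 * a * b * inner f g + b ^+ 2 * inner g g.
  by rewrite -inner_comb// inner_ge0.
have := inner_ge0 f; have := inner_ge0 g.
move: (inner f f) (inner f g) (inner g g) pos => A B C pos C0 A0.
have [Cz|Cn0] := eqVneq C 0.
  (* the form is then affine in b, hence constant *)
  have [->|B0] := eqVneq B 0; first by rewrite expr0n/= mulr_ge0.
  have B2 : 0 < B ^+ 2 by rewrite exprn_even_gt0.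
  by have := pos B (- (A + 1)); rewrite Cz; nra.
have Cp : 0 < C by rewrite lt_def Cn0.
have := pos C (- B); rewrite (_ : _ + _ = C * (A * C - B ^+ 2)); last by ring.
by rewrite pmulr_rge0// subr_ge0.
Qed.

Lemma inner_null f g : bmfun f -> bmfun g -> inner f f = 0 -> inner f g = 0.
Proof.
move=> bf bg f0; have := inner_CS bf bg; rewrite f0 mul0r => h.
by apply/eqP; rewrite -sqrf_eq0; apply/eqP/le_anti; rewrite h sqr_ge0.
Qed.

End inner_product.

Section operator.
Context {R : realType} d (T : measurableType d) (P : probability T R).
Variable U : T -> T -> R.
Hypothesis bU : bmfun (fun p : T * T => U p.1 p.2).
Hypothesis symU : forall x y, U x y = U y x.

Definition Top (f : T -> R) (x : T) : R := \int[P]_y (U x y * f y).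

Lemma bmU x : bmfun (U x).
Proof. exact: (bmfun_sectionr bU). Qed.

Section parameter.
Context d' (Y : measurableType d') (Q : probability Y R).

Lemma bmfun_Top_param (f : Y -> T -> R) :
  bmfun (fun p : Y * T => f p.1 p.2) ->
  bmfun (fun p : Y * T => Top (f p.1) p.2).
Proof.
move=> bf; apply: (@bmfun_Rintr _ _ _ _ _ (Q \x P)%E P
  (fun p : (Y * T) * T => U p.1.2 p.2 * f p.1.1 p.2)).
apply: bmfunM.
  apply: (@bmfun_comp _ _ _ _ _ (fun p => (p.1.2, p.2)) _ _ bU).
  by apply: measurable_fun_pair => //; exact: measurableT_comp.
apply: (@bmfun_comp _ _ _ _ _ (fun p => (p.1.1, p.2)) _ _ bf).
by apply: measurable_fun_pair => //; exact: measurableT_comp.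
Qed.

Lemma bmfun_iter_param k (f : Y -> T -> R) :
  bmfun (fun p : Y * T => f p.1 p.2) ->
  bmfun (fun p : Y * T => iter k Top (f p.1) p.2).
Proof.
by move=> bf; elim: k => // k IHk; exact: (@bmfun_Top_param (fun y => iter k Top (f y))).
Qed.

End parameter.

Lemma bmfun_Top f : bmfun f -> bmfun (Top f).
Proof.
move=> bf; apply: (@bmfun_Rintr _ _ _ _ _ P P (fun p : T * T => U p.1 p.2 * f p.2)).
by apply: bmfunM => //; exact: (bmfun_comp (@measurable_snd _ _ T T) bf).
Qed.

Lemma bmfun_iter k f : bmfun f -> bmfun (iter k Top f).
Proof. by move=> bf; elim: k => // k IHk; exact: bmfun_Top. Qed.

Lemma TopZ c f : bmfun f -> Top (fun x => c * f x) = (fun x => c * Top f x).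
Proof.
move=> bf; apply/funext => x; rewrite /Top -RintZ; last exact: bmfunM (bmU x) bf.
by apply: eq_Rint => y; rewrite mulrCA.
Qed.

Lemma iter_TopZ k c f : bmfun f ->
  iter k Top (fun x => c * f x) = (fun x => c * iter k Top f x).
Proof.
by move=> bf; elim: k => //= k ->; rewrite TopZ//; exact: bmfun_iter.
Qed.

Lemma Top_selfadjoint f g : bmfun f -> bmfun g ->
  inner P (Top f) g = inner P f (Top g).
Proof.
move=> bf bg.
have b : bmfun (fun p : T * T => g p.1 * (U p.1 p.2 * f p.2)).
  apply: bmfunM; first exact: (bmfun_comp (@measurable_fst _ _ T T) bg).
  by apply: bmfunM => //; exact: (bmfun_comp (@measurable_snd _ _ T T) bf).
transitivity (\int[P]_x \int[P]_y (g x * (U x y * f y))).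
  apply: eq_Rint => x; rewrite mulrC /Top RintZ//.
  exact: bmfunM (bmU x) bf.
rewrite (Rint_swap P P b)/=; apply: eq_Rint => y.
transitivity (\int[P]_x (f y * (U y x * g x))).
  by apply: eq_Rint => x; rewrite (symU x y); ring.
by rewrite RintZ//; exact: bmfunM (bmU y) bg.
Qed.

Lemma iter_selfadjoint k f g : bmfun f -> bmfun g ->
  inner P (iter k Top f) g = inner P f (iter k Top g).
Proof.
move=> bf bg; elim: k g bg => // k IHk g bg; rewrite [in LHS]iterS.
by rewrite Top_selfadjoint ?IHk ?iterSr//; [exact: bmfun_Top|exact: bmfun_iter].
Qed.

(** The density at a root of closed walks with [k.+1] edges. *)
Definition closed_walk k (x : T) : R := iter k Top (U x) x.

Lemma bmfun_closed_walk k : bmfun (closed_walk k).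
Proof.
apply: (@bmfun_comp _ _ _ _ _ (fun x : T => (x, x))
  (fun p => iter k Top (U p.1) p.2)).
  exact: measurable_fun_pair.
exact: (bmfun_iter_param P).
Qed.

Definition cycle_density k : R := \int[P]_x closed_walk k x.

Lemma closed_walk_inner a b x :
  closed_walk (a + b).+1 x = inner P (iter a Top (U x)) (iter b Top (U x)).
Proof.
rewrite iter_selfadjoint; [|exact: bmU|exact/bmfun_iter/bmU].
by rewrite -iterD.
Qed.

(** A closed walk of even length is a walk of half the length there and back. *)
Lemma cycle_density_ge0 k : 0 <= cycle_density k.*2.+1.
Proof.
apply: Rint_ge0 => x; rewrite -addnn closed_walk_inner; exact: inner_ge0.
Qed.

(** Self-adjointness makes the vanishing of a power of the operator propagate
down to the operator itself. *)
Lemma iter_null k f : (forall g, bmfun g -> inner P (iter k.+1 Top g) (iter k.+1 Top g) = 0) ->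
  bmfun f -> inner P (Top f) (Top f) = 0.
Proof.
elim: k => [|k IHk] null bf; first exact: null.
apply: IHk => [g bg|]; last exact: bf.
rewrite [in X in inner P X _]iterS Top_selfadjoint; [|exact: bmfun_iter..].
rewrite innerC; apply: inner_null; [exact: (bmfun_iter k.+2)|exact: bmfun_iter|].
exact: null.
Qed.

(** A kernel in which some even cycle has density zero acts as zero. *)
Lemma cycle_density_null k : cycle_density k.*2.+1 = 0 ->
  forall f, bmfun f -> inner P (Top f) (Top f) = 0.
Proof.
move=> c0 f; apply: (@iter_null k) => g bg.
have bk h : bmfun h -> bmfun (iter k.+1 Top h) by exact: bmfun_iter.
have bUk x : bmfun (iter k Top (U x)) by exact/bmfun_iter/bmU.
(* T^(k+1) g is at x the pairing of g with T^k (U x), whose squared norm is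
   the density of closed walks at x *)
pose q x := inner P (iter k Top (U x)) g.
have qE x : q x = iter k.+1 Top g x.
  by rewrite /q iter_selfadjoint//; exact: bmU.
have bq : bmfun q by apply: eq_bmfun (bk _ bg) => x; rewrite qE.
suff : inner P q q = 0.
  by move=> <-; apply: eq_Rint => x; rewrite !qE.
apply/le_anti; rewrite inner_ge0 andbT.
rewrite -[leRHS](mulr0 (inner P g g)) -c0 /cycle_density -RintZ; last first.
  exact: bmfun_closed_walk.
apply: le_Rint; [exact: bmfunM|exact/bmfunZ/bmfun_closed_walk|move=> x].
by rewrite -addnn closed_walk_inner -expr2 mulrC; exact: inner_CS.
Qed.

(** Reads [k] points off a sequence as the steps of a walk from [x] and passes
the end of the walk and the remaining points on. *)
Fixpoint walk k (x : T) (F : T -> seq T -> R) (s : seq T) : R :=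
  match k, s with
  | 0, _ => F x s
  | k'.+1, y :: s' => U x y * walk k' y F s'
  | _.+1, [::] => 0
  end.

Section walk_parameter.
Context d' (Y : measurableType d').

Lemma bmfun_walk k m (F : Y -> T -> seq T -> R) :
  bmfun (fun p : Y * T * m.-tuple T => F p.1.1 p.1.2 p.2) ->
  bmfun (fun p : Y * T * (k + m).-tuple T => walk k p.1.2 (F p.1.1) p.2).
Proof.
move=> bF; elim: k => // k IHk.
apply: (@eq_bmfun _ _ _ (fun p : Y * T * (k + m).+1.-tuple T =>
  U p.1.2 (thead p.2) * walk k (thead p.2) (F p.1.1) [tuple of behead p.2])).
  by move=> [[y x] t] /=; rewrite [in RHS](tuple_eta t).
have mh : measurable_fun [set: Y * T * (k + m).+1.-tuple T] (fun p => thead p.2).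
  exact: (measurableT_comp (@measurable_tnth _ T _ ord0)).
apply: bmfunM.
  apply: (@bmfun_comp _ _ _ _ _ (fun p => (p.1.2, thead p.2)) _ _ bU).
  by apply: measurable_fun_pair => //; exact: measurableT_comp.
apply: (@bmfun_comp _ _ _ _ _
  (fun p => ((p.1.1, thead p.2), [tuple of behead p.2])) _ _ IHk).
apply: measurable_fun_pair; last first.
  exact: (measurableT_comp (@measurable_behead _ T (k + m))).
by apply: measurable_fun_pair => //; exact: measurableT_comp.
Qed.

End walk_parameter.

Lemma bmfun_walk1 k m (F : T -> seq T -> R) :
  bmfun (fun p : T * m.-tuple T => F p.1 p.2) ->
  bmfun (fun p : T * (k + m).-tuple T => walk k p.1 F p.2).
Proof.
move=> bF; apply: (@bmfun_comp _ _ _ _ _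
  (fun p : T * (k + m).-tuple T => ((p.1, p.1), p.2))
  (fun p : T * T * (k + m).-tuple T => walk k p.1.2 F p.2)).
  by apply: measurable_fun_pair => //; apply: measurable_fun_pair.
apply: (@bmfun_walk _ T k m (fun _ => F)).
apply: (@bmfun_comp _ _ _ _ _ (fun p => (p.1.2, p.2)) _ _ bF).
by apply: measurable_fun_pair => //; exact: measurableT_comp.
Qed.

Lemma bmseq_walk k m (F : T -> seq T -> R) x :
  bmfun (fun p : T * m.-tuple T => F p.1 p.2) -> bmseq (k + m) (walk k x F).
Proof. by move=> /(@bmfun_walk1 k)/(bmfun_comp (pair1_measurable x)); exact. Qed.

Lemma Ex_walk k m (F : T -> seq T -> R) x :
  bmfun (fun p : T * m.-tuple T => F p.1 p.2) ->
  Ex P (k + m) (walk k x F) = iter k Top (fun y => Ex P m (F y)) x.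
Proof.
move=> bF; elim: k => // k IHk in x *.
rewrite /= Ex_S; last exact: (@bmseq_walk k.+1).
apply: eq_Rint => y; rewrite ExZ ?IHk//; exact: bmseq_walk.
Qed.

(** A closed walk from [x], and independent further points. *)
Definition cwalk k (x : T) (G : seq T -> R) : seq T -> R :=
  walk k x (fun y s => U y x * G s).

Lemma bmfun_cwalk k m (G : T -> seq T -> R) :
  bmfun (fun p : T * m.-tuple T => G p.1 p.2) ->
  bmfun (fun p : T * (k + m).-tuple T => cwalk k p.1 (G p.1) p.2).
Proof.
move=> bG; apply: (@bmfun_comp _ _ _ _ _
  (fun p : T * (k + m).-tuple T => ((p.1, p.1), p.2))
  (fun p : T * T * (k + m).-tuple T =>
     walk k p.1.2 (fun y s => U y p.1.1 * G p.1.1 s) p.2)).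
  by apply: measurable_fun_pair => //; apply: measurable_fun_pair.
apply: (@bmfun_walk _ _ k m (fun x y s => U y x * G x s)).
apply: bmfunM.
  apply: (@bmfun_comp _ _ _ _ _ (fun p => (p.1.2, p.1.1)) _ _ bU).
  by apply: measurable_fun_pair => //; exact: measurableT_comp.
apply: (@bmfun_comp _ _ _ _ _ (fun p => (p.1.1, p.2)) _ _ bG).
by apply: measurable_fun_pair => //; exact: measurableT_comp.
Qed.

Lemma bmseq_cwalk k m x G : bmseq m G -> bmseq (k + m) (cwalk k x G).
Proof.
move=> bG; apply: bmseq_walk; apply: bmfunM.
  apply: (@bmfun_comp _ _ _ _ _ (fun p => (p.1, x)) _ _ bU).
  exact: measurable_fun_pair.
exact: (bmfun_comp (@measurable_snd _ _ T (m.-tuple T)) bG).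
Qed.

Lemma Ex_cwalk k m x G : bmseq m G ->
  Ex P (k + m) (cwalk k x G) = closed_walk k x * Ex P m G.
Proof.
move=> bG; rewrite /cwalk Ex_walk; last first.
  apply: bmfunM.
    apply: (@bmfun_comp _ _ _ _ _ (fun p => (p.1, x)) _ _ bU).
    exact: measurable_fun_pair.
  exact: (bmfun_comp (@measurable_snd _ _ T (m.-tuple T)) bG).
rewrite (_ : (fun y => _) = (fun y => Ex P m G * U x y)); last first.
  by apply/funext => y; rewrite ExZ// mulrC symU.
by rewrite iter_TopZ 1?mulrC//; exact: bmU.
Qed.

Definition rooted (F : T -> seq T -> R) (s : seq T) : R :=
  if s is x :: s' then F x s' else 0.

Lemma bmseq_rooted m (F : T -> seq T -> R) :
  bmfun (fun p : T * m.-tuple T => F p.1 p.2) -> bmseq m.+1 (rooted F).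
Proof.
move=> bF; apply: (@eq_bmfun _ _ _ (fun t : m.+1.-tuple T =>
  F (thead t) [tuple of behead t])).
  by move=> t; rewrite [in RHS](tuple_eta t).
apply: (@bmfun_comp _ _ _ _ _ (fun t => (thead t, [tuple of behead t])) _ _ bF).
apply: measurable_fun_pair; last exact: measurable_behead.
exact: measurable_tnth.
Qed.

Lemma Ex_rooted m (F : T -> seq T -> R) :
  bmfun (fun p : T * m.-tuple T => F p.1 p.2) ->
  Ex P m.+1 (rooted F) = \int[P]_x Ex P m (F x).
Proof. by move=> bF; rewrite Ex_S//; exact: bmseq_rooted. Qed.

Lemma Ex_cycle k m G : bmseq m G ->
  Ex P (k + m).+1 (rooted (fun x => cwalk k x G)) = cycle_density k * Ex P m G.
Proof.
move=> bG; rewrite Ex_rooted; last first.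
  apply: (@bmfun_cwalk k m (fun _ => G)).
  exact: (bmfun_comp (@measurable_snd _ _ T (m.-tuple T)) bG).
under eq_Rint do rewrite Ex_cwalk// mulrC.
by rewrite RintZ 1?mulrC//; exact: bmfun_closed_walk.
Qed.

End operator.

(** * Graphs drawn on natural numbers *)

Definition pattern := (nat * seq (nat * nat))%type.

(** Written with conditionals rather than boolean connectives so that
evaluation stops early, also under call by value. *)
Fixpoint adj (es : seq (nat * nat)) (a b : nat) : bool :=
  if es is (c, d) :: es' then
    if (if eqn a c then eqn b d else false) then true
    else if (if eqn a d then eqn b c else false) then true
    else adj es' a b
  else false.

Fixpoint simple (es : seq (nat * nat)) : bool :=
  if es is p :: es' then
    [&& p.1 != p.2, ~~ adj es' p.1 p.2 & simple es']
  else true.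

Definition bounded (n : nat) (es : seq (nat * nat)) : bool :=
  all (fun p => (p.1 < n)%N && (p.2 < n)%N) es.

Definition cycle_pat (n : nat) : pattern :=
  (n, [seq (i, i.+1 %% n)%N | i <- iota 0 n]).

Definition path_pat (n : nat) : pattern :=
  (n.+1, [seq (i, i.+1) | i <- iota 0 n]).

(** Vertex [0] of [Q] is identified with vertex [r] of [P]. *)
Definition glue_pat (P : pattern) (r : nat) (Q : pattern) : pattern :=
  let sh i := if i is i'.+1 then (P.1 + i')%N else r in
  ((P.1 + Q.1).-1, P.2 ++ [seq (sh p.1, sh p.2) | p <- Q.2]).

Definition union_pat (P Q : pattern) : pattern :=
  ((P.1 + Q.1)%N, P.2 ++ [seq (P.1 + p.1, P.1 + p.2)%N | p <- Q.2]).

Definition cc_pat (k l : nat) : pattern :=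
  glue_pat (cycle_pat k) 0 (cycle_pat l).

Definition cpc_pat (k n l : nat) : pattern :=
  glue_pat (glue_pat (cycle_pat k) 0 (path_pat n)) (k + n).-1 (cycle_pat l).

Lemma adjE es a b : adj es a b = ((a, b) \in es) || ((b, a) \in es).
Proof.
elim: es => //= -[c d] es ->; rewrite !inE !xpair_eqE /= !eqnE.
by case: (a == c); case: (b == d); case: (a == d); case: (b == c);
  rewrite //= ?orbT ?orbF.
Qed.

Lemma adjC es a b : adj es a b = adj es b a.
Proof. by rewrite !adjE orbC. Qed.

Lemma set2_eq (V : finType) (a b c d : V) :
  [set a; b]%SET = [set c; d]%SET ->
  (a = c /\ b = d) \/ (a = d /\ b = c).
Proof.
move=> e.
have := set21 a b; have := set22 a b; have := set21 c d; have := set22 c d.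
rewrite -{1 2}e {3 4}e !inE.
move=> /orP[]/eqP-> /orP[]/eqP-> /orP[]/eqP h /orP[]/eqP h'; by [left|right|subst; left|subst; right].
Qed.

Section images.
Variable V : finType.
Implicit Types (e : nat -> V) (es : seq (nat * nat)).

Definition edge_images e es : seq {set V} :=
  [seq [set e p.1; e p.2]%SET | p <- es].

Definition inj_below n e : Prop :=
  forall i j, (i < n)%N -> (j < n)%N -> e i = e j -> i = j.

Lemma mem_edge_images n e es a b : inj_below n e -> bounded n es ->
  (a < n)%N -> (b < n)%N ->
  ([set e a; e b]%SET \in edge_images e es) = adj es a b.
Proof.
move=> einj /allP bd an bn; rewrite adjE; apply/mapP/orP => [[[i j] ijes /set2_eq /= h]|].
  have /andP[/= ilt jlt] := bd _ ijes.
  case: h => -[/einj ai /einj bj]; [left|right];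
    by rewrite ai// bj.
by case=> h; [exists (a, b)|exists (b, a) => //=; rewrite finset.setUC].
Qed.

Lemma uniq_edge_images n e es : inj_below n e -> bounded n es -> simple es ->
  uniq (edge_images e es).
Proof.
move=> einj; elim: es => //= -[a b] es IHes /= /andP[/andP[an bn] bd].
move=> /and3P[_ nadj sm]; rewrite IHes// andbT.
by rewrite (mem_edge_images einj bd).
Qed.

(** [F] is the edge set of a copy of [P]; vertices on no edge are ignored. *)
Definition has_shape (F : {set {set V}}) (P : pattern) : Prop :=
  exists2 e, inj_below P.1 e & F =i edge_images e P.2.

End images.

(** * Exhaustive search *)

Fixpoint nbrs es a : seq nat :=
  if es is (c, d) :: es' then
    if eqn a c then d :: nbrs es' a
    else if eqn a d then c :: nbrs es' a else nbrs es' a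
  else [::].

Fixpoint any T (q : T -> bool) (s : seq T) : bool :=
  if s is x :: s' then if q x then true else any q s' else false.

Fixpoint every T (q : T -> bool) (s : seq T) : bool :=
  if s is x :: s' then if q x then every q s' else false else true.

(** A pattern together with, for each of its vertices from [k] on, the
neighbours that come before it. *)
Definition guided (k : nat) (P : pattern) : pattern * seq (seq nat) :=
  (P, [seq [seq a <- nbrs P.2 v | (a < v)%N] | v <- iota k (P.1 - k)]).

(** Depth-first search for a copy of a pattern inside [es]; [l] lists the
images of the vertices placed so far and [bs] the neighbourhoods, among the
earlier vertices, of the vertices still to be placed. *)
Fixpoint place n es (bs : seq (seq nat)) (l : seq nat) : option (seq nat) :=
  if bs is b :: bs' then
    (fix try cs := if cs is v :: cs' then
        if any (eqn v) l then try cs'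
        else if every (fun a => adj es (nth 0 l a) v) b then
          if place n es bs' (rcons l v) is Some l' then Some l' else try cs'
        else try cs'
      else None) (if b is a :: _ then nbrs es (nth 0 l a) else iota 0 n)
  else Some l.

Definition is_copy n es (P : pattern) (l : seq nat) : bool :=
  [&& size l == P.1, uniq l, all (fun i => i < n)%N l &
    all (fun p => adj es (nth 0 l p.1) (nth 0 l p.2)) P.2].

Definition has_copy n es (Q : pattern * seq (seq nat)) (l : seq nat) : bool :=
  if place n es Q.2 l is Some l' then is_copy n es Q.1 l' else false.

Definition pendant n es : option nat :=
  ohead [seq v <- iota 0 n | if nbrs es v is [:: _] then true else false].

Definition closes (cyc : seq (pattern * seq (seq nat))) n es : bool :=
  if es is p :: _ then any (fun C => has_copy n es C [:: p.1; p.2]) cyc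
  else false.

(** Grows a list of [k] fewer edges than the target towards every edge set of
minimum degree two: a vertex of degree one must have another edge, and if there
is no such vertex then any further edge may be added.  A branch is cut when its
last edge closes a cycle listed in [cyc]; the others must end, when all edges
are placed, with a vertex of degree one or with a copy of a pattern listed in
[good] or [bad]. *)
Fixpoint explore (cyc bad good : seq (pattern * seq (seq nat))) k n es : bool :=
  match k, pendant n es with
  | 0, Some _ => true
  | 0, None =>
      if closes cyc n es then true
      else if any (fun Q => has_copy n es Q [::]) bad then true
      else any (fun Q => if eqn (size Q.1.2) (size es)
                         then has_copy n es Q [::] else false) good
  | k'.+1, Some v =>
      if closes cyc n es then true
      else if explore cyc bad good k' n.+1 ((v, n) :: es) then
        every (fun w => if eqn v w then true else if adj es v w then true
                        else explore cyc bad good k' n ((v, w) :: es)) (iota 0 n)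
      else false
  | k'.+1, None =>
      if closes cyc n es then true
      else if every (fun v => explore cyc bad good k' n.+1 ((v, n) :: es))
                (iota 0 n) then
        if every (fun v => every (fun w =>
               if eqn v w then true else if adj es v w then true
               else explore cyc bad good k' n ((v, w) :: es)) (iota 0 v))
             (iota 0 n) then
          explore cyc bad good k' n.+2 ((n, n.+1) :: es)
        else false
      else false
  end.

Lemma anyE T (q : T -> bool) s : any q s = has q s.
Proof. by elim: s => //= x s <-; case: (q x). Qed.

Lemma everyE T (q : T -> bool) s : every q s = all q s.
Proof. by elim: s => //= x s <-; case: (q x). Qed.

Lemma mem_nbrs es a b : adj es a b -> b \in nbrs es a.
Proof.
elim: es => //= -[c d] es IHes; rewrite !eqnE.
have [ac|_] := eqVneq a c; rewrite ?inE.
  have [//|bd] := eqVneq b d; case: ifP => [|_ /IHes //].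
  have [ad|//] := eqVneq a d.
  by move=> /eqP bc; rewrite bc -ac ad eqxx in bd.
have [_|_ /IHes //] := eqVneq a d; rewrite ?inE.
by have [//|_ /IHes] := eqVneq b c.
Qed.

Lemma nbrs_adj es a b : b \in nbrs es a -> adj es a b.
Proof.
elim: es => //= -[c d] es IHes; rewrite !eqnE.
have [_|_] := eqVneq a c.
  by rewrite inE; have [//|_ /IHes ->] := eqVneq b d; rewrite if_same.
have [_|_ /IHes ->//] := eqVneq a d.
by rewrite inE; have [//|_ /IHes] := eqVneq b c.
Qed.

Section soundness.
Variables (V : finType) (F : {set {set V}}).
Hypothesis F_pairs : forall A, A \in F ->
  exists a b, a != b /\ A = [set a; b]%SET.
Hypothesis F_min_degree : forall A v, A \in F -> v \in A ->
  exists B, [/\ B \in F, B != A & v \in B].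

(** The invariant of the search. *)
Definition drawn_in n es (e : nat -> V) : Prop :=
  [/\ inj_below n e, bounded n es, simple es &
      {subset edge_images e es <= F}].

Definition avoided (P : pattern) : Prop :=
  forall e, inj_below P.1 e -> ~ {subset edge_images e P.2 <= F}.

Lemma mem_edges (e : nat -> V) es a b : adj es a b ->
  [set e a; e b]%SET \in edge_images e es.
Proof.
rewrite adjE => /orP[] h; apply/mapP; first by exists (a, b).
by exists (b, a) => //=; rewrite finset.setUC.
Qed.

Lemma has_copy_sound n es e Q l : drawn_in n es e -> has_copy n es Q l ->
  exists2 e', inj_below Q.1.1 e' & {subset edge_images e' Q.1.2 <= F}.
Proof.
move=> [einj bd _ sub]; rewrite /has_copy; case: place => // l'.
move=> /and4P[/eqP sl ul /allP ln /allP le].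
exists (e \o nth 0%N l') => [i j|A /mapP[p pP ->]].
  rewrite -sl => il jl /einj ij; apply/eqP.
  by rewrite -(nth_uniq 0%N il jl ul); apply/eqP/ij; exact/ln/mem_nth.
exact/sub/mem_edges/le.
Qed.

Lemma shape_full (P : pattern) e : bounded P.1 P.2 -> simple P.2 ->
  inj_below P.1 e -> {subset edge_images e P.2 <= F} ->
  #|F| = size P.2 -> has_shape F P.
Proof.
move=> bd sm einj sub cF; exists e => //.
have /(_ (enum F)) := uniq_min_size (uniq_edge_images einj bd sm).
case; first by move=> A /sub; rewrite mem_enum.
  by rewrite -cardE cF size_map.
by move=> _ h A; rewrite -mem_enum.
Qed.

Lemma drawn_old n es e v w : drawn_in n es e -> (v < n)%N -> (w < n)%N ->
  v != w -> ~~ adj es v w -> [set e v; e w]%SET \in F ->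
  drawn_in n ((v, w) :: es) e.
Proof.
move=> [einj bd sm sub] vn wn vw nadj vwF; split=> //=.
- by rewrite vn wn.
- by rewrite vw nadj.
- by move=> A; rewrite inE => /orP[/eqP->|/sub].
Qed.

Lemma edge_images_eq n es (e e' : nat -> V) : bounded n es ->
  (forall i, (i < n)%N -> e' i = e i) -> edge_images e' es = edge_images e es.
Proof.
move=> /allP bd ee; apply/eq_in_map => p /bd /andP[p1 p2].
by rewrite !ee.
Qed.

Lemma bounded_adj n es a b : bounded n es -> adj es a b -> (a < n)%N /\ (b < n)%N.
Proof. by move=> /allP bd; rewrite adjE => /orP[] /bd /andP[]. Qed.

Lemma bounded_leq n n' es : (n <= n')%N -> bounded n es -> bounded n' es.
Proof.
by move=> nn'; apply: sub_all => p /andP[p1 p2]; rewrite (leq_trans p1 nn') (leq_trans p2 nn').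
Qed.

Lemma drawn_new n es e v y : drawn_in n es e -> (v < n)%N ->
  (forall i, (i < n)%N -> e i != y) -> [set e v; y]%SET \in F ->
  drawn_in n.+1 ((v, n) :: es) (fun i => if i == n then y else e i).
Proof.
move=> [einj bd sm sub] vn ynew vyF; split=> /=.
- move=> i j; rewrite (ltnS i) (ltnS j) (leq_eqVlt i) (leq_eqVlt j).
  case: eqP => [->|_] /= ilt; case: eqP => [->|_] //= jlt ij.
  + by case/eqP: (ynew _ jlt).
  + by case/eqP: (ynew _ ilt).
  + exact: einj.
- by rewrite ltnS leqnn (ltnW vn)/= (bounded_leq (leqnSn n) bd).
- rewrite sm andbT neq_ltn vn/=.
  by apply/negP => /(bounded_adj bd)[_]; rewrite ltnn.
- rewrite eqxx (ltn_eqF vn); move=> A; rewrite inE => /orP[/eqP-> //|].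
  rewrite (edge_images_eq (e := e) bd); first exact: sub.
  by move=> i ilt; rewrite (ltn_eqF ilt).
Qed.

Lemma drawn_new2 n es e x y : drawn_in n es e -> x != y ->
  (forall i, (i < n)%N -> e i != x) -> (forall i, (i < n)%N -> e i != y) ->
  [set x; y]%SET \in F ->
  drawn_in n.+2 ((n, n.+1) :: es)
    (fun i => if i == n.+1 then y else if i == n then x else e i).
Proof.
move=> [einj bd sm sub] xy xnew ynew xyF.
apply: (@drawn_new n.+1 es (fun i => if i == n then x else e i)) => //.
- split=> //.
  + move=> i j; rewrite (ltnS i) (ltnS j) (leq_eqVlt i) (leq_eqVlt j).
    case: eqP => [->|_] /= ilt; case: eqP => [->|_] //= jlt ij.
    * by case/eqP: (xnew _ jlt).
    * by case/eqP: (xnew _ ilt).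
    * exact: einj.
  + exact: bounded_leq bd.
  + move=> A; rewrite (edge_images_eq (e := e) bd); first exact: sub.
    by move=> i ilt; rewrite (ltn_eqF ilt).
- move=> i; rewrite ltnS (leq_eqVlt i); case: eqP => //= _; exact: ynew.
- by rewrite eqxx.
Qed.

Variables cyc bad good : seq (pattern * seq (seq nat)).
Hypothesis cyc_avoided : forall Q, Q \in cyc -> avoided Q.1.
Hypothesis bad_avoided : forall Q, Q \in bad -> avoided Q.1.
Hypothesis good_wf : forall Q, Q \in good ->
  bounded Q.1.1 Q.1.2 && simple Q.1.2.

Lemma pendantP n es v : pendant n es = Some v ->
  (v < n)%N /\ exists u, nbrs es v = [:: u].
Proof.
rewrite /pendant; case E : [seq _ <- _ | _] => [|w s] //= [wv]; subst w.
have : v \in [seq v <- iota 0 n | if nbrs es v is [:: _] then true else false].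
  by rewrite E mem_head.
rewrite mem_filter mem_iota; case: (nbrs es v) => [//|u [|//]] /andP[_].
by case/andP => _ vn; split => //; exists u.
Qed.

(** The search can follow an edge of [F] at a drawn vertex in two ways. *)
Lemma drawn_step n es e v y (concl : Prop) :
  drawn_in n es e -> (v < n)%N -> [set e v; y]%SET \in F ->
  [set e v; y]%SET \notin edge_images e es ->
  (forall w, (w < n)%N -> y = e w -> drawn_in n ((v, w) :: es) e ->
     v != w -> ~~ adj es v w -> concl) ->
  (drawn_in n.+1 ((v, n) :: es) (fun i => if i == n then y else e i) -> concl) ->
  concl.
Proof.
move=> dr vn vyF vyes Hold Hnew.
have [/mapP[w]|ynew] := boolP (y \in map e (iota 0 n)).
  rewrite mem_iota => /andP[_ wn] yw.
  have vw : v != w.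
    apply/eqP => vw; have [a [b [ab /set2_eq]]] := F_pairs vyF.
    by rewrite yw vw => -[] [ea eb]; rewrite -ea -eb eqxx in ab.
  have nadj : ~~ adj es v w.
    by apply: contra vyes => /(@mem_edges e); rewrite yw.
  by apply: (Hold w) => //; apply: drawn_old => //; rewrite -yw.
apply: Hnew; apply: drawn_new => // i ilt.
apply: contraNneq ynew => <-; apply: map_f.
by rewrite mem_iota.
Qed.

Lemma closes_sound n es e : drawn_in n es e -> closes cyc n es = false.
Proof.
move=> dr; apply/negP; rewrite /closes; case: es dr => // p es dr.
rewrite anyE => /hasP[Q Qin] /(has_copy_sound dr)[e' inje' sube'].
exact: (cyc_avoided Qin inje').
Qed.

Lemma drawn_all n es e : drawn_in n es e -> size es = #|F| ->
  F =i edge_images e es.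
Proof.
move=> [einj bd sm sub] szF A.
have [||_ eqF] := uniq_min_size (uniq_edge_images einj bd sm) (s2 := enum F).
- by move=> B /sub; rewrite mem_enum.
- by rewrite -cardE size_map szF.
- by rewrite eqF mem_enum.
Qed.

(** The edge comes from the minimum degree; if it were drawn, it would be the
only drawn edge at the vertex. *)
Lemma pendant_edge n es e v : drawn_in n es e -> pendant n es = Some v ->
  exists2 y, [set e v; y]%SET \in F & [set e v; y]%SET \notin edge_images e es.
Proof.
move=> dr /pendantP[vn [u nv]]; have [einj bd sm sub] := dr.
have vu : adj es v u by apply: nbrs_adj; rewrite nv mem_head.
have [B [BF BA vB]] := F_min_degree (sub _ (mem_edges e vu)) (set21 _ _).
have [y By] : exists y, B = [set e v; y]%SET.
  have [a [b [_ Bab]]] := F_pairs BF; move: vB; rewrite Bab !inE.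
  by case/orP => /eqP->; [exists b|exists a; rewrite finset.setUC].
exists y; rewrite -By//; apply: contra BA => Bes; apply/eqP.
have /mapP[[i j] ij Bij] := Bes.
have [il jl] : (i < n)%N /\ (j < n)%N by apply: (bounded_adj bd); rewrite adjE ij.
move: (Bij); rewrite By => /set2_eq /= [[/einj vi yj]|[/einj vj yi]].
  have vj : adj es v j by rewrite adjE vi// ij.
  by move/mem_nbrs: vj; rewrite nv inE => /eqP ju; rewrite yj ju.
have vi : adj es v i by rewrite adjE vj// ij orbT.
by move/mem_nbrs: vi; rewrite nv inE => /eqP iu; rewrite yi iu.
Qed.

(** Some branch of the search always follows [F]: a vertex of degree one is on
an edge of [F] that is not yet drawn, and otherwise [F] has such an edge as
long as fewer than [#|F|] edges are drawn. *)
Lemma explore_sound k n es e : drawn_in n es e -> (size es + k = #|F|)%N ->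
  explore cyc bad good k n es ->
  exists2 Q, Q \in good & has_shape F Q.1.
Proof.
elim: k n es e => [|k IHk] n es e dr szF.
  rewrite addn0 in szF; rewrite /explore (closes_sound dr).
  case pE : (pendant n es) => [v|] => [_|].
    by have [y yF] := pendant_edge dr pE; rewrite -(drawn_all dr szF) yF.
  rewrite !anyE; case: ifP => [/hasP[Q Qin] /(has_copy_sound dr)[e' inje' sube'] _|_].
    by case: (bad_avoided Qin inje').
  move=> /hasP[Q Qin]; rewrite eqnE; case: eqP => // szQ /(has_copy_sound dr)[e' inje' sube'].
  have /andP[bdQ smQ] := good_wf Qin.
  by exists Q => //; apply: shape_full sube' _; rewrite // -szF szQ.
have szS es' : size es' = (size es).+1 -> (size es' + k = #|F|)%N.
  by move=> ->; rewrite addSnnS.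
rewrite [explore _ _ _ _ _ _]/= (closes_sound dr).
case pE : (pendant n es) => [v|].
  case: ifP => // Hnew; rewrite everyE => /allP Hold.
  have [y yF yes] := pendant_edge dr pE; have [vn _] := pendantP pE.
  apply: (drawn_step dr vn yF yes) => [w wn _ dr' vw nadj|dr'].
    apply: (IHk _ _ _ dr'); first exact: szS.
    have := Hold w; rewrite mem_iota wn => /(_ isT).
    by rewrite eqnE (negPf vw) (negPf nadj).
  by apply: (IHk _ _ _ dr') => //; exact: szS.
rewrite !everyE; case: ifP => // /allP Hnew; case: ifP => // /allP Hold Hnew2.
have [B BF Bes] : exists2 B, B \in F & B \notin edge_images e es.
  have [/existsP[B /andP[]]|] := boolP [exists B in F, B \notin edge_images e es].
    by exists B.
  rewrite negb_exists_in => /forall_inP sub'.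
  have /(uniq_leq_size (enum_uniq F)) : {subset enum F <= edge_images e es}.
    by move=> A; rewrite mem_enum => /sub'; rewrite negbK.
  by rewrite -cardE size_map -szF addnS ltnNge leq_addr.
have [x [y [xy Bxy]]] := F_pairs BF; subst B.
have step v z : (v < n)%N -> [set e v; z]%SET \in F ->
    [set e v; z]%SET \notin edge_images e es ->
    exists2 Q, Q \in good & has_shape F Q.1.
  move=> vn zF zes.
  apply: (drawn_step dr vn zF zes) => [w wn zw dr' vw nadj|dr']; last first.
    by apply: (IHk _ _ _ dr'); [exact: szS|apply: Hnew; rewrite mem_iota].
  have Hvw u1 u2 : (u1 < n)%N -> (u2 < u1)%N -> ~~ adj es u1 u2 ->
      explore cyc bad good k n ((u1, u2) :: es).
    move=> u1n u21 /negPf nadj'; have := Hold u1.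
    rewrite mem_iota u1n everyE => /(_ isT)/allP h; have := h u2.
    by rewrite mem_iota u21 => /(_ isT); rewrite eqnE (gtn_eqF u21) nadj'.
  have [wv|vw'|vw'] := ltngtP w v.
  - by apply: (IHk _ _ _ dr'); [exact: szS|exact: Hvw].
  - apply: (IHk n ((w, v) :: es) e); [|exact: szS|].
      by apply: drawn_old; rewrite // 1?eq_sym// 1?adjC// finset.setUC -zw.
    by apply: Hvw; rewrite // adjC.
  - by rewrite vw' eqxx in vw.
have [/mapP[v]|xnew] := boolP (x \in map e (iota 0 n)).
  rewrite mem_iota => /andP[_ vn] xv; rewrite xv in BF Bes *.
  exact: step vn BF Bes.
have [/mapP[v]|ynew] := boolP (y \in map e (iota 0 n)).
  rewrite mem_iota => /andP[_ vn] yv; rewrite finset.setUC yv in BF Bes *.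
  exact: step vn BF Bes.
have notin z : z \notin map e (iota 0 n) -> forall i, (i < n)%N -> e i != z.
  by move=> znew i ilt; apply: contraNneq znew => <-; apply: map_f; rewrite mem_iota.
have dr' := drawn_new2 dr xy (notin _ xnew) (notin _ ynew) BF.
by apply: (IHk _ _ _ dr'); [exact: szS|].
Qed.

End soundness.

Definition even_cycles := [:: cycle_pat 4; cycle_pat 6; cycle_pat 8].

Definition excluded :=
  [:: cc_pat 3 3; cc_pat 3 5; cc_pat 3 7; cpc_pat 3 2 3].

Definition shapes6 := [:: union_pat (cycle_pat 3) (cycle_pat 3)].
Definition shapes8 := [:: union_pat (cycle_pat 3) (cycle_pat 5)].
Definition shapes10 :=
  [:: cpc_pat 3 2 5; cpc_pat 3 4 3; cc_pat 5 5; cycle_pat 10;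
      union_pat (cycle_pat 3) (cpc_pat 3 1 3);
      union_pat (cycle_pat 5) (cycle_pat 5);
      union_pat (cycle_pat 3) (cycle_pat 7)].

(** * Densities of edge sets *)

Section density.
Context {R : realType} d (T : measurableType d) (P : probability T R) (x0 : T).
Variable U : T -> T -> R.
Hypothesis bU : bmfun (fun p : T * T => U p.1 p.2).
Hypothesis symU : forall x y, U x y = U y x.
Variable V : finType.
Implicit Types (x : V -> T) (A B : {set V}) (F E : {set {set V}}).

Definition edge_val x A : R :=
  if [pick p : V * V | A == [set p.1; p.2]%SET] is Some p
  then U (x p.1) (x p.2) else 1.

Definition dens F : R := ExV P (fun x => \prod_(A in F) edge_val x A).

Lemma edge_val_set2 x a b : edge_val x [set a; b]%SET = U (x a) (x b).
Proof.
rewrite /edge_val; case: pickP => [p /eqP /set2_eq[] [-> ->] //|/(_ (a, b))].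
by rewrite eqxx.
Qed.

Lemma eq_edge_val x x' A : {in A, x =1 x'} -> edge_val x A = edge_val x' A.
Proof.
move=> xx'; rewrite /edge_val; case: pickP => // p /eqP Ap.
by rewrite !xx' ?Ap ?set21 ?set22.
Qed.

Lemma bmV_edge_val A : bmV (fun x => edge_val x A).
Proof.
rewrite /bmV /edge_val; case: pickP => [p _|_]; last exact: bmfun_cst.
apply: (@bmfun_comp _ _ _ _ _ (fun t : #|V|.-tuple T =>
  (tnth t (enum_rank p.1), tnth t (enum_rank p.2))) _ _ bU).
by apply: measurable_fun_pair; exact: measurable_tnth.
Qed.

Lemma bmV_prod F : bmV (fun x => \prod_(A in F) edge_val x A).
Proof. by apply: bmfun_prod => A _; exact: bmV_edge_val. Qed.

Lemma bmseq_edge_val (vs : seq V) A : (forall v, v \in vs) ->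
  bmseq (size vs) (fun s => edge_val (fun v => nth x0 s (index v vs)) A).
Proof.
move=> vsT; rewrite /bmseq /edge_val; case: pickP => [p _|_]; last exact: bmfun_cst.
by apply: bmseq_nth2 => //; rewrite index_mem.
Qed.

Lemma ExV_enum (vs : seq V) F : uniq vs -> (forall v, v \in vs) ->
  dens F = Ex P (size vs) (fun s =>
    \prod_(A in F) edge_val (fun v => nth x0 s (index v vs)) A).
Proof.
move=> uvs vsT; rewrite -ExV_map//; last first.
  by apply: bmfun_prod => A _; exact: bmseq_edge_val.
apply: eq_Rint => t; apply: eq_bigr => A _; apply: eq_edge_val => v _.
by rewrite (nth_map v) ?nth_index// index_mem.
Qed.

(** No other edge contains both ends of the edge [[set a; b]], so once the
other points are fixed, integrating over its ends gives a matrix coefficient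
of the integral operator. *)
Lemma dens_edge_null F a b : a != b ->
  (forall A, A \in F -> exists c d, A = [set c; d]%SET) ->
  [set a; b]%SET \in F ->
  (forall f g, bmfun f -> bmfun g ->
     ((forall B, B \in F -> B != [set a; b]%SET -> a \notin B) -> f =1 fun=> 1) ->
     inner P (Top P U f) g = 0) ->
  dens F = 0.
Proof.
move=> ab pairs abF null; set A0 := [set a; b]%SET in abF null.
pose rest := [seq v <- enum V | v \notin A0].
pose vs := [:: a, b & rest].
have vsT v : v \in vs.
  rewrite !inE mem_filter mem_enum andbT !inE.
  by case: eqP => //; case: eqP.
have uvs : uniq vs.
  rewrite /= !inE !mem_filter set21 set22 /= orbF ab /=.
  by rewrite filter_uniq// enum_uniq.
rewrite (ExV_enum F uvs vsT) /=; set k := size rest.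
pose xs s v := nth x0 s (index v vs).
rewrite -[X in Ex _ _ X]/(fun s => \prod_(A in F) edge_val (xs s) A).
pose F1 := [pred A | [&& A \in F, A != A0 & a \in A]].
pose F2 := [pred A | [&& A \in F, A != A0 & a \notin A]].
have bm (Q : pred {set V}) : bmseq k.+2 (fun s => \prod_(A | Q A) edge_val (xs s) A).
  by apply: bmfun_prod => A _; exact: (@bmseq_edge_val vs).
have bmF := bm [in F].
rewrite Ex_S_swap// Ex_S_swap; last exact: (bmseq_Rint_cons P bmF).
rewrite -[RHS](Ex_cst P k); apply: eq_Ex => s sk.
pose f y := \prod_(A | F1 A) edge_val (xs [:: y, x0 & s]) A.
pose g z := \prod_(A | F2 A) edge_val (xs [:: x0, z & s]) A.
have bf : bmfun f by apply: (bmfun_cons (bm F1)); rewrite /= sk.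
have bg : bmfun g by apply: (bmfun_cons (bmseq_cons (bm F2) x0)).
rewrite -(null f g bf bg); last first.
  move=> pend y; rewrite /f big_pred0// => A; apply/negP => /and3P[AF AA0 aA].
  by have := pend A AF AA0; rewrite aA.
apply: eq_Rint => z; rewrite /Top mulrC -RintZ; last first.
  exact: (bmfunM (bmU bU z)).
apply: eq_Rint => y.
rewrite (bigD1 A0)//= (bigID (fun A => a \in A))/=.
have -> : edge_val (xs [:: y, z & s]) A0 = U z y.
  rewrite edge_val_set2 symU /xs /= eqxx (negPf ab).
  by rewrite eqxx.
rewrite [RHS]mulrCA (mulrC (g z)); congr (_ * (_ * _)).
  rewrite /f; apply: eq_big => [A|A /andP[/andP[AF AA0] aA]].
    by rewrite /= andbA.
  apply: eq_edge_val => v vA; rewrite /xs /=; case: eqP => // av.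
  case: eqP => // bv; case/eqP: AA0; have [c [d' Acd]] := pairs A AF.
  move: aA vA; rewrite -bv Acd /A0 !inE => /orP[]/eqP ac /orP[]/eqP bd.
  - by rewrite ac bd eqxx in ab.
  - by rewrite ac bd.
  - by rewrite ac bd finset.setUC.
  - by rewrite ac bd eqxx in ab.
rewrite /g; apply: eq_big => [A|A /andP[/andP[AF AA0] aA]]; first by rewrite /= andbA.
apply: eq_edge_val => v vA; rewrite /xs /=; case: eqP => // av.
by rewrite av vA in aA.
Qed.

(** Integrating over a vertex of degree one leaves the degree function of the
kernel, which is the image of the constant function one. *)
Lemma dens_pendant F a A :
  (forall A, A \in F -> exists c d, c != d /\ A = [set c; d]%SET) ->
  inner P (Top P U (fun=> 1)) (Top P U (fun=> 1)) = 0 ->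
  A \in F -> a \in A -> (forall B, B \in F -> B != A -> a \notin B) ->
  dens F = 0.
Proof.
move=> pairs T1 AF aA pend; have [c [e [ce Ace]]] := pairs A AF.
have [b ab Aab] : exists2 b, a != b & A = [set a; b]%SET.
  move: aA; rewrite Ace !inE => /orP[]/eqP->; first by exists e.
  by exists c; rewrite 1?eq_sym// finset.setUC.
rewrite Aab in AF pend; apply: (dens_edge_null ab _ AF) => [B /pairs[u [v [_ ->]]]|f g bf bg f1].
  by exists u, v.
have -> : f = fun=> 1 by apply/funext => y; exact: f1.
by apply: inner_null => //; apply: bmfun_Top => //; exact: bmfun_cst.
Qed.

Lemma dens_null F :
  (forall A, A \in F -> exists c d, c != d /\ A = [set c; d]%SET) ->
  (forall f, bmfun f -> inner P (Top P U f) (Top P U f) = 0) ->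
  F != finset.set0 -> dens F = 0.
Proof.
move=> pairs null /set0Pn[A AF]; have [a [b [ab Aab]]] := pairs A AF.
rewrite Aab in AF; apply: (dens_edge_null ab _ AF) => [B /pairs[u [v [_ ->]]]|f g bf bg _].
  by exists u, v.
by apply: inner_null => //; [exact: bmfun_Top|exact: null].
Qed.

Definition pat_val (es : seq (nat * nat)) (s : seq T) : R :=
  \prod_(p <- es) U (nth x0 s p.1) (nth x0 s p.2).

Lemma bmseq_pat_val n es : bounded n es -> bmseq n (pat_val es).
Proof.
elim: es => [_|p es IHes /= /andP[/andP[p1 p2] bd]].
  apply: (@eq_bmfun _ _ _ (fun=> 1)); last exact: bmfun_cst.
  by move=> t; rewrite /pat_val big_nil.
apply: (@eq_bmseq _ _ _ _ (fun s => U (nth x0 s p.1) (nth x0 s p.2) * pat_val es s)).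
  by move=> s _; rewrite /pat_val big_cons.
by apply: bmfunM (IHes bd); exact: bmseq_nth2.
Qed.

Lemma dens_shape F (Q : pattern) : bounded Q.1 Q.2 -> simple Q.2 ->
  has_shape F Q -> dens F = Ex P Q.1 (pat_val Q.2).
Proof.
case: Q => n es /= bd sm [e /= einj eF].
have uvs : uniq (map e (iota 0 n)).
  rewrite map_inj_in_uniq ?iota_uniq// => i j.
  rewrite !mem_iota => /andP[_ ilt] /andP[_ jlt]; exact: einj.
have szvs : size (map e (iota 0 n)) = n by rewrite size_map size_iota.
rewrite -[in RHS]szvs -ExV_map//; last by rewrite szvs; exact: bmseq_pat_val.
apply: eq_Rint => t; rewrite /pat_val.
rewrite (eq_bigl [in edge_images e es])// -big_uniq/=; last exact: uniq_edge_images bd sm.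
rewrite big_map big_seq [RHS]big_seq; apply: eq_bigr => p pes.
have /andP[p1 p2] := allP bd _ pes.
rewrite edge_val_set2 -map_comp !(nth_map 0%N) ?size_iota// !nth_iota//.
Qed.

Lemma ExV_expand E (c eps : R) :
  ExV P (fun x : V -> T => \prod_(A in E) (c + eps * edge_val x A)) =
  \sum_(F : {set {set V}} | F \subset E)
     c ^+ (#|E| - #|F|) * eps ^+ #|F| * dens F.
Proof.
transitivity (\int[power_prob P #|V|]_t
  (\sum_(F : {set {set V}} | F \subset E) c ^+ (#|E| - #|F|) * eps ^+ #|F| *
     \prod_(A in F) edge_val (fun v => tnth t (enum_rank v)) A)).
  apply: eq_Rint => t; set ev := edge_val _.
  transitivity (\prod_A ((if A \in E then eps * ev A else 0) +
      (if A \in E then c else 1))).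
    by rewrite big_mkcond; apply: eq_bigr => A _; case: ifP => _; rewrite ?add0r// addrC.
  rewrite bigA_distr [RHS]big_mkcond/=; apply: eq_bigr => F _.
  case: ifPn => [/fintype.subsetP FE|/subsetPn[A AF AE]]; last first.
    by rewrite (bigD1 A)//= AF (negPf AE) mul0r.
  have cD : #|E :\: F| = (#|E| - #|F|)%N.
    by rewrite cardsD; congr (_ - #|pred_of_set _|)%N; apply/finset.setIidPr/fintype.subsetP.
  rewrite (bigID [in F])/= -[RHS]mulrA [RHS]mulrC; congr (_ * _).
    transitivity (\prod_(A in F) (eps * ev A)).
      by apply: eq_bigr => A AF; rewrite AF FE.
    by rewrite big_split/= prodr_const.
  rewrite -cD -prodr_const big_mkcond [RHS]big_mkcond/=.
  apply: eq_bigr => A _; rewrite inE; case: (A \in F) => //=.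
rewrite Rint_sum => [|F _]; last by apply: bmfunZ; exact: bmV_prod.
by apply: eq_bigr => F _; rewrite RintZ//; exact: bmV_prod.
Qed.

End density.

(** * Densities of cycles, dumbbells and unions *)

Section pattern_densities.
Context {R : realType} d (T : measurableType d) (P : probability T R) (x0 : T).
Variable U : T -> T -> R.
Hypothesis bU : bmfun (fun p : T * T => U p.1 p.2).
Hypothesis symU : forall x y, U x y = U y x.

Local Notation "''T'" := (Top P U).
Local Notation W := (closed_walk P U).
Local Notation C k := (cycle_density P U k).
Definition pat_dens (Q : pattern) : R := Ex P Q.1 (pat_val x0 U Q.2).

Let bm1 : bmseq 0 (fun _ : seq T => 1 : R).
Proof. exact: bmfun_cst. Qed.

Let bmT : bmfun (fun _ : T * 0.-tuple T => 1 : R).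
Proof. exact: bmfun_cst. Qed.

Lemma pat_val_shift k (Q : pattern) s s' : size s = k ->
  pat_val x0 U [seq (k + p.1, k + p.2)%N | p <- Q.2] (s ++ s') =
  pat_val x0 U Q.2 s'.
Proof.
move=> sk; rewrite /pat_val big_map; apply: eq_bigr => p _.
by rewrite !nth_cat sk !ltnNge !leq_addr !addKn.
Qed.

Lemma pat_val_cat es es' s :
  pat_val x0 U (es ++ es') s = pat_val x0 U es s * pat_val x0 U es' s.
Proof. exact: big_cat. Qed.

(** Points of different components are independent. *)
Lemma pat_dens_triangle_union Q : bounded Q.1 Q.2 ->
  pat_dens (union_pat (cycle_pat 3) Q) = C 2 * pat_dens Q.
Proof.
move=> bd; rewrite -(Ex_cycle P bU symU _ (bmseq_pat_val x0 bU bd)); apply: eq_Ex.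
move=> [|x [|y [|z s]]] //= _.
rewrite -[LHS]/(pat_val x0 U ((cycle_pat 3).2 ++
  [seq (3 + p.1, 3 + p.2)%N | p <- Q.2]) ([:: x; y; z] ++ s)).
rewrite pat_val_cat (@pat_val_shift 3 Q [:: x; y; z])// /cwalk /= !mulrA; congr (_ * _).
by rewrite /pat_val /cwalk /= unlock /=; ring.
Qed.

Lemma pat_dens_pentagon_union Q : bounded Q.1 Q.2 ->
  pat_dens (union_pat (cycle_pat 5) Q) = C 4 * pat_dens Q.
Proof.
move=> bd; rewrite -(Ex_cycle P bU symU _ (bmseq_pat_val x0 bU bd)); apply: eq_Ex.
move=> [|x [|y [|z [|u [|v s]]]]] //= _.
rewrite -[LHS]/(pat_val x0 U ((cycle_pat 5).2 ++
  [seq (5 + p.1, 5 + p.2)%N | p <- Q.2]) ([:: x; y; z; u; v] ++ s)).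
rewrite pat_val_cat (@pat_val_shift 5 Q [:: x; y; z; u; v])// /cwalk /= !mulrA; congr (_ * _).
by rewrite /pat_val /cwalk /= unlock /=; ring.
Qed.

Let Ex_cycle1 k : Ex P k.+1 (rooted (fun x => cwalk U k x (fun=> 1))) = C k.
Proof.
have := Ex_cycle P bU symU k bm1; rewrite addn0 => ->.
by rewrite Ex_cst mulr1.
Qed.

Lemma pat_dens_C3 : pat_dens (cycle_pat 3) = C 2.
Proof.
rewrite -Ex_cycle1; apply: eq_Ex => -[|a [|b [|c [|]]]] //= _.
by rewrite /pat_val /cwalk /= unlock /=; ring.
Qed.

Lemma pat_dens_C5 : pat_dens (cycle_pat 5) = C 4.
Proof.
rewrite -Ex_cycle1; apply: eq_Ex => -[|a [|b [|c [|e [|f [|]]]]]] //= _.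
by rewrite /pat_val /cwalk /= unlock /=; ring.
Qed.

Lemma pat_dens_C10 : pat_dens (cycle_pat 10) = C 9.
Proof.
rewrite -Ex_cycle1; apply: eq_Ex.
move=> [|a [|b [|c [|e [|f [|g [|h [|i [|j [|k [|]]]]]]]]]]] //= _.
by rewrite /pat_val /cwalk /= unlock /=; ring.
Qed.

Let Ex_cwalk1 k x : Ex P k (cwalk U k x (fun=> 1)) = W k x.
Proof.
have := Ex_cwalk P bU symU k x bm1; rewrite addn0 => ->.
by rewrite Ex_cst mulr1.
Qed.

Let bmfun_cwalk1 k : bmfun (fun p : T * k.-tuple T => cwalk U k p.1 (fun=> 1) p.2).
Proof. by have := @bmfun_cwalk _ _ _ U bU k 0 (fun _ _ => 1) bmT; rewrite addn0. Qed.

Lemma pat_dens_cc55 : pat_dens (cc_pat 5 5) = inner P (W 4) (W 4).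
Proof.
transitivity (Ex P 9 (rooted (fun x => cwalk U 4 x (cwalk U 4 x (fun=> 1))))).
  apply: eq_Ex.
  move=> [|a [|b [|c [|e [|f [|g [|h [|i [|j [|]]]]]]]]]] //= _.
  by rewrite /pat_val /cwalk /= unlock /=; ring.
rewrite (@Ex_rooted _ _ _ P (4 + 4)); last first.
  exact: (@bmfun_cwalk _ _ _ U bU 4 4 (fun x => cwalk U 4 x (fun=> 1)) (bmfun_cwalk1 4)).
apply: eq_Rint => x; rewrite (@Ex_cwalk _ _ _ P U bU symU 4 4) ?Ex_cwalk1//.
exact: (bmseq_cwalk bU 4 x bm1).
Qed.

(** Two closed walks joined by a path of even length: half of the path is
moved to the other factor by self-adjointness. *)
Let Ex_dumbbell k n l :
  Ex P (k + (n.*2 + l)).+1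
    (rooted (fun x => cwalk U k x (walk U n.*2 x (fun y => cwalk U l y (fun=> 1))))) =
  inner P (iter n 'T (W k)) (iter n 'T (W l)).
Proof.
have bl := bmfun_cwalk1 l.
have bnl := @bmfun_walk1 _ _ _ U bU n.*2 l (fun y => cwalk U l y (fun=> 1)) bl.
rewrite Ex_rooted; last exact: (@bmfun_cwalk _ _ _ U bU k (n.*2 + l)
  (fun x => walk U n.*2 x (fun y => cwalk U l y (fun=> 1))) bnl).
rewrite iter_selfadjoint//; [|exact: bmfun_closed_walk|exact/bmfun_iter/bmfun_closed_walk].
apply: eq_Rint => x; rewrite Ex_cwalk//; last first.
  exact: (@bmseq_walk _ _ _ U bU n.*2 l (fun y => cwalk U l y (fun=> 1)) x bl).
have -> := @Ex_walk _ _ _ P U bU n.*2 l (fun y => cwalk U l y (fun=> 1)) x bl.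
have -> : (fun y => Ex P l (cwalk U l y (fun=> 1))) = W l.
  by apply/funext => y; rewrite Ex_cwalk1.
by rewrite -iterD addnn.
Qed.

Lemma pat_dens_cpc343 :
  pat_dens (cpc_pat 3 4 3) = inner P (iter 2 'T (W 2)) (iter 2 'T (W 2)).
Proof.
rewrite -Ex_dumbbell; apply: eq_Ex.
move=> [|a [|b [|c [|e [|f [|g [|h [|i [|j [|]]]]]]]]]] //= _.
by rewrite /pat_val /cwalk /= unlock /=; ring.
Qed.

Lemma pat_dens_cpc325 :
  pat_dens (cpc_pat 3 2 5) = inner P (iter 2 'T (W 2)) (W 4).
Proof.
rewrite iterS Top_selfadjoint//; [|exact/bmfun_iter/bmfun_closed_walk|exact: bmfun_closed_walk].
rewrite -[RHS]/(inner P (iter 1 'T (W 2)) (iter 1 'T (W 4))) -Ex_dumbbell; apply: eq_Ex.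
move=> [|a [|b [|c [|e [|f [|g [|h [|i [|j [|]]]]]]]]]] //= _.
by rewrite /pat_val /cwalk /= unlock /=; ring.
Qed.

Lemma pat_dens_path2 :
  pat_dens (path_pat 2) = inner P ('T (fun=> 1)) ('T (fun=> 1)).
Proof.
transitivity (Ex P 3 (rooted (fun x => walk U 2 x (fun _ _ => 1)))).
  apply: eq_Ex => -[|a [|b [|c [|]]]] //= _.
  by rewrite /pat_val /cwalk /= unlock /=; ring.
rewrite Ex_rooted; last exact: (@bmfun_walk1 _ _ _ U bU 2 0 (fun _ _ => 1) bmT).
rewrite Top_selfadjoint//; [|exact: bmfun_cst|exact/bmfun_Top/bmfun_cst].
apply: eq_Rint => x; rewrite mul1r (@Ex_walk _ _ _ P U bU 2 0 (fun _ _ => 1) x bmT).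
have -> : (fun y : T => Ex P 0 (fun=> 1)) = (fun=> 1).
  by apply/funext => y; rewrite Ex_cst.
by [].
Qed.

Lemma pat_dens_path1_union : 0 <= pat_dens (union_pat (path_pat 1) (path_pat 1)).
Proof.
pose e := Ex P 2 (rooted (fun x => walk U 1 x (fun _ _ => 1))).
have b2 : bmseq 2 (rooted (fun x => walk U 1 x (fun _ _ => 1))).
  by apply: bmseq_rooted; exact: (@bmfun_walk1 _ _ _ U bU 1 0 (fun _ _ => 1) bmT).
suff -> : pat_dens (union_pat (path_pat 1) (path_pat 1)) = e * e.
  by rewrite -expr2 sqr_ge0.
pose g s := rooted (fun x => walk U 1 x (fun _ _ => 1)) s : R.
transitivity (Ex P 4 (rooted (fun x => walk U 1 x (fun _ s => g s)))).
  apply: eq_Ex => -[|a [|b [|c [|f [|]]]]] //= _.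
  by rewrite /pat_val /cwalk /= unlock /=; ring.
have b2' : bmfun (fun p : T * 2.-tuple T => g p.2).
  exact: (bmfun_comp (@measurable_snd _ _ T (2.-tuple T)) b2).
rewrite Ex_rooted; last exact: (@bmfun_walk1 _ _ _ U bU 1 2 (fun _ s => g s) b2').
rewrite {1}/e Ex_rooted; last exact: (@bmfun_walk1 _ _ _ U bU 1 0 (fun _ _ => 1) bmT).
rewrite [RHS]mulrC -RintZ; last first.
  have := @bmfun_Ex_cons _ _ _ P 1 _ b2; exact.
apply: eq_Rint => x; rewrite (@Ex_walk _ _ _ P U bU 1 2 (fun _ s => g s) x b2')
  (@Ex_walk _ _ _ P U bU 1 0 (fun _ _ => 1) x bmT).
have TZ : Top P U (fun=> e * 1) = (fun x => e * Top P U (fun=> 1) x).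
  by apply: (TopZ P bU); exact: bmfun_cst.
rewrite /= -[X in Top P U (fun=> X) _]mulr1 TZ.
have -> : (fun y : T => Ex P 0 (fun=> 1)) = (fun=> 1).
  by apply/funext => y; rewrite Ex_cst.
by [].
Qed.

End pattern_densities.

(** * Local behaviour of the density of a perturbed constant kernel *)

(** Close to zero a polynomial has the sign of its lowest term. *)
Lemma leading_term (R : realFieldType) (q : nat -> R) n m : (m < n)%N ->
  (forall k, (k < m)%N -> q k = 0) -> 0 < q m ->
  exists2 e0 : R, 0 < e0 &
    forall e, 0 < e < e0 -> 0 < \sum_(k < n) q k * e ^+ k.
Proof.
move=> mn q0 qm; pose B := \sum_(k < n) `|q k|.
have B0 : 0 <= B by apply: sumr_ge0.
exists (Num.min 1 (q m / (B + 1))).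
  by rewrite lt_min ltr01 divr_gt0// ltr_wpDl.
move=> e /andP[e0]; rewrite lt_min => /andP[e1].
rewrite ltr_pdivlMr ?ltr_wpDl// => eB.
have mn' := mn; rewrite (bigD1 (Ordinal mn))//=.
have tail : - (B * e ^+ m.+1) <=
    \sum_(k < n | k != Ordinal mn) q k * e ^+ k.
  rewrite mulr_suml -sumrN big_mkcond [leRHS]big_mkcond/=.
  rewrite [leRHS]big_mkcond [leLHS]big_mkcond /=.
  apply: ler_sum => k _; case: ifPn => [km|_]; last first.
    by rewrite oppr_le0 mulr_ge0// exprn_ge0// ltW.
  have [km'|mk] := ltnP k m.
    by rewrite q0// mul0r normr0 mul0r oppr0.
  have {}mk : (m < k)%N.
    by rewrite ltn_neqAle mk andbT eq_sym; apply: contraNneq km => h; exact/eqP/val_inj.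
  have le_e : e ^+ k <= e ^+ m.+1 by apply: ler_wiXn2l => //; exact: ltW.
  have ek : 0 <= e ^+ k by rewrite exprn_ge0// ltW.
  have := ler_norm (- q k); have := normr_ge0 (q k); rewrite normrN; nra.
have em : 0 < e ^+ m by rewrite exprn_gt0.
apply: lt_le_trans (lerD (lexx _) tail).
by rewrite exprS; nra.
Qed.

Section hom_density.
Variables (R : realType) (H : sgraph).
Local Notation I := (`[0, 1]%classic : set R).

(** Extension by zero, to have a kernel that is bounded and measurable on the
whole plane. *)
Definition cutoff (U : R -> R -> R) (x y : R) : R :=
  if (x \in I) && (y \in I) then U x y else 0.

Lemma bmfun_cutoff U : is_kernel U ->
  bmfun (fun p : measurableTypeR R * measurableTypeR R => cutoff U p.1 p.2).
Proof.
move=> [mU [M UM] _]; split.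
  have := (measurable_restrictT (fun p : R * R => U p.1 p.2)
    (measurableX (measurable_itv `[0, 1]) (measurable_itv `[0, 1]))).1 mU.
  rewrite (_ : _ \_ _ = fun p => cutoff U p.1 p.2)//.
  apply/funext => -[x y].
  by rewrite /cutoff patchE in_setX.
exists `|M| => -[x y] /=; rewrite /cutoff; case: ifPn => [|_]; last by rewrite normr0.
by move=> /andP[/set_mem xI /set_mem yI]; rewrite (le_trans (UM _ _ xI yI))// ler_norm.
Qed.

Lemma cutoff_sym U : is_kernel U -> forall x y, cutoff U x y = cutoff U y x.
Proof.
move=> [_ _ symU] x y; rewrite /cutoff andbC; case: ifP => // /andP[/set_mem yI /set_mem xI].
exact: symU.
Qed.

Lemma cutoffE U x y : I x -> I y -> cutoff U x y = U x y.
Proof. by move=> xI yI; rewrite /cutoff !mem_set. Qed.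

(** Every edge has exactly one orientation by increasing rank. *)
Lemma prod_edges (f : H -> H -> R) (g : {set H} -> R) :
  (forall a b, edge a b -> g [set a; b]%SET = f a b) ->
  \prod_(e : H * H | edge e.1 e.2 && (enum_rank e.1 < enum_rank e.2)%N) f e.1 e.2 =
  \prod_(A in edges H) g A.
Proof.
move=> gf; pose h (e : H * H) := [set e.1; e.2]%SET.
have -> : edges H =
    [set h e | e in [pred e | edge e.1 e.2 && (enum_rank e.1 < enum_rank e.2)%N]]%SET.
  apply/setP => A; rewrite inE; apply/existsP/imsetP => [[a /existsP[b]]|].
    move=> /andP[ab /eqP ->].
    have [ltab|ltba|eab] := ltngtP (enum_rank a) (enum_rank b).
    - by exists (a, b); rewrite // inE /= ab ltab.
    - by exists (b, a); rewrite // ?inE /h /= 1?finset.setUC// edge_sym ab ltba.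
    - by move/val_inj/enum_rank_inj: eab ab => ->; rewrite edge_irrefl.
  move=> [[a b]]; rewrite inE => /andP[/= ab _] ->.
  by exists a; apply/existsP; exists b; rewrite ab /=.
rewrite big_imset/=.
  by apply: eq_bigr => e /andP[ee _]; rewrite gf.
move=> [a b] [c d]; rewrite !inE /= => /andP[_ ab] /andP[_ cd].
move=> /set2_eq /= [[-> ->] //|[ad bc]].
by move: ab; rewrite ad bc ltnNge ltnW.
Qed.

Lemma hom_density_ExV (U U' : R -> R -> R) (c e : R) :
  bmfun (fun p : measurableTypeR R * measurableTypeR R => U' p.1 p.2) ->
  (forall x y, U' x y = U' y x) ->
  (forall x y, I x -> I y -> U' x y = U x y) ->
  hom_density H (fun x y => c + e * U x y) =
  ExV (lebesgue01 R) (fun x : H -> R =>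
    \prod_(A in edges H) (c + e * edge_val U' x A)).
Proof.
move=> bU symU UU'.
rewrite /hom_density; set D := [set x : #|H|.-tuple (measurableTypeR R) | _].
have mI : measurable I by exact: measurable_itv.
have mD : measurable D by apply: (@measurable_box _ _ #|H| (fun _ => I)).
pose f (t : #|H|.-tuple (measurableTypeR R)) := \prod_(A in edges H)
  (c + e * edge_val U' (fun v => tnth t (enum_rank v)) A).
transitivity (\int[power_prob (lebesgue01 R) #|H|]_(t in D) f t).
  apply: eq_Rintegral => t /set_mem Dt.
  apply: (prod_edges (f := fun a b => c + e * U (tnth t (enum_rank a)) (tnth t (enum_rank b)))).
  by move=> a b ab; rewrite edge_val_set2// UU'//; exact: Dt.
have PD1 : power_prob (lebesgue01 R) #|H| D = 1%E.
  transitivity (\prod_(i < #|H|) lebesgue01 R I)%E; first exact: power_prob_box.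
  rewrite big1// => i _; rewrite lebesgue01E// setIid lebesgue_measure_itv /=.
  by rewrite lte_fin ltr01 oppr0 adde0.
have PD : power_prob (lebesgue01 R) #|H| (~` D) = 0%E.
  by have := probability_setC (power_prob (lebesgue01 R) #|H|) mD; rewrite PD1 subee.
have bf : bmfun f.
  apply: bmfun_prod => A _; apply: bmfunD; first exact: bmfun_cst.
  by apply: bmfunZ; exact: bmV_edge_val.
have := @negligible_integral _ _ _ (power_prob (lebesgue01 R) #|H|) setT (~` D)
  (EFin \o f) (measurableC mD) measurableT (bmfun_integrable _ bf) PD.
by rewrite setTD setCK /ExV /Rintegral => ->.
Qed.

End hom_density.

Definition search good m :=
  explore (map (guided 2) even_cycles) (map (guided 0) excluded)
    (map (guided 0) good) m 0 [::].

Section search.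
Variables (V : finType) (F : {set {set V}}).
Hypothesis F_pairs : forall A, A \in F ->
  exists a b, a != b /\ A = [set a; b]%SET.
Hypothesis F_min_degree : forall A v, A \in F -> v \in A ->
  exists B, [/\ B \in F, B != A & v \in B].
Hypothesis F_avoids : forall P, P \in even_cycles ++ excluded -> avoided F P.

(** A graph of minimum degree two without even cycles consists of edge-disjoint
odd cycles and bridges; with at most ten edges there are few such graphs, and
only the decagon is added when longer even cycles are allowed.  The search goes
through all of them. *)
Lemma search_sound good : F != finset.set0 ->
  all (fun P => bounded P.1 P.2 && simple P.2) good -> search good #|F| ->
  exists2 P, P \in good & has_shape F P.
Proof.
move=> /set0Pn[A AF] /allP wf; have [a [b _]] := F_pairs AF.
have dr : drawn_in F 0 [::] (fun=> a) by split.
case/(explore_sound F_pairs F_min_degree _ _ _ dr (add0n _)).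
- move=> _ /mapP[P PC ->]; apply: F_avoids; by rewrite mem_cat PC.
- move=> _ /mapP[P PC ->]; apply: F_avoids; by rewrite mem_cat PC orbT.
- move=> _ /mapP[P Pg ->]; exact: wf.
- by move=> _ /mapP[P Pg ->] ?; exists P.
Qed.

End search.

Lemma search2 : search [::] 2. Proof. by vm_compute. Qed.
Lemma search4 : search [::] 4. Proof. by vm_compute. Qed.
Lemma search6 : search shapes6 6. Proof. by vm_compute. Qed.
Lemma search8 : search shapes8 8. Proof. by vm_compute. Qed.
Lemma search10 : search shapes10 10. Proof. by vm_compute. Qed.

(** * Copies of a graph and its drawings *)

(** A numbering of the vertices of [G] that turns [G] into [P]. *)
Record labels (G : sgraph) (P : pattern) (lab : G -> nat) : Prop := Labels {
  lab_inj : injective lab;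
  lab_lt : forall x, (lab x < P.1)%N;
  lab_onto : forall i, (i < P.1)%N -> exists x, lab x = i;
  lab_bounded : bounded P.1 P.2;
  lab_edge : forall x y, edge x y = adj P.2 (lab x) (lab y) }.

Lemma labels_cycle n :
  @labels (cycle_graph n.+3) (cycle_pat n.+3) (@nat_of_ord _).
Proof.
split.
- exact: val_inj.
- by move=> x; exact: ltn_ord.
- by move=> i ilt; exists (Ordinal (ilt : (i < n.+3)%N)).
- apply/allP => _ /mapP[i + ->] /=; rewrite mem_iota => /andP[_ ilt].
  by rewrite ilt ltn_mod.
- move=> x y; rewrite adjE.
  have mem (a b : 'I_n.+3) :
      ((a : nat, b : nat) \in [seq (i, i.+1 %% n.+3)%N | i <- iota 0 n.+3]) = (b == ordS a).
    apply/mapP/eqP => [[i _ [ai bE]]|->]; first by apply: val_inj; rewrite /= bE ai.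
    by exists (a : nat); rewrite ?mem_iota /= ?ltn_ord.
  rewrite [edge x y]/(cycle_rel x y) /cycle_rel {1 2}/cycle_pat [(_, _).2]/=  !mem.
  case: eqVneq => //= ->; rewrite orbb; apply/esym/negP => /eqP.
  move/(congr1 (@nat_of_ord _)) => /= yE.
  have := ltn_ord y; rewrite leq_eqVlt => /orP[/eqP yn|ylt].
    by rewrite yn modnn in yE; rewrite yE in yn.
  by rewrite modn_small// in yE; lia.
Qed.

Lemma labels_path n : @labels (path_graph n) (path_pat n) (@nat_of_ord _).
Proof.
split.
- exact: val_inj.
- by move=> x; exact: ltn_ord.
- by move=> i ilt; exists (Ordinal (ilt : (i < n.+1)%N)).
- apply/allP => _ /mapP[i + ->] /=; rewrite mem_iota => /andP[_ ilt].
  by rewrite !ltnS ilt ltnW.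
- move=> /= x y; rewrite adjE /path_rel.
  have mem (a b : 'I_n.+1) :
      ((a : nat, b : nat) \in [seq (i, i.+1) | i <- iota 0 n]) = (b == a.+1 :> nat).
    apply/mapP/eqP => [[i _ [-> ->]]//|bE]; exists (a : nat); rewrite ?mem_iota ?bE//=.
    by have := ltn_ord b; rewrite bE ltnS.
  by rewrite !mem.
Qed.

Lemma adj_cat es es' a b : adj (es ++ es') a b = adj es a b || adj es' a b.
Proof. by rewrite !adjE !mem_cat orbACA. Qed.

Lemma adj_map (f : nat -> nat) es a b :
  adj es a b -> adj [seq (f p.1, f p.2) | p <- es] (f a) (f b).
Proof.
rewrite !adjE => /orP[] h; apply/orP; [left|right]; apply/mapP.
  by exists (a, b).
by exists (b, a).
Qed.

Lemma adj_mapP (f : nat -> nat) es a b :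
  adj [seq (f p.1, f p.2) | p <- es] a b ->
  exists i j, [/\ adj es i j, a = f i & b = f j].
Proof.
rewrite adjE => /orP[] /mapP[[i j] ij [-> ->]].
  by exists i, j; rewrite adjE ij.
by exists j, i; rewrite adjE ij orbT.
Qed.

Section glue_labels.
Variables (G1 G2 : sgraph) (v1 : G1) (v2 : G2) (P Q : pattern).
Variables (lab1 : G1 -> nat) (lab2 : G2 -> nat).
Hypotheses (l1 : labels P lab1) (l2 : labels Q lab2) (lab20 : lab2 v2 = 0%N).

Definition glue_lab (z : glue v1 v2) : nat :=
  match z with
  | inl x => lab1 x
  | inr y => (P.1 + (lab2 (val y)).-1)%N
  end.

Let sh i := if i is i'.+1 then (P.1 + i')%N else lab1 v1.

Let sh0 i : (sh i < P.1)%N -> i = 0%N.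
Proof. by case: i => //= i; rewrite ltnNge leq_addr. Qed.

Let sh_lab2 (y : {y : G2 | y != v2}) :
  (P.1 + (lab2 (val y)).-1)%N = sh (lab2 (val y)).
Proof.
case: y => y /= yv; case E : (lab2 y) => [|i] //=.
by case/eqP: yv; apply: (lab_inj l2); rewrite lab20.
Qed.

Let sh_inj : injective sh.
Proof.
have r := lab_lt l1 v1.
case=> [|i] [|j] //= h; first by rewrite h ltnNge leq_addr in r.
  by rewrite -h ltnNge leq_addr in r.
by have /addnI -> := h.
Qed.

Lemma labels_glue : @labels (glue v1 v2) (glue_pat P (lab1 v1) Q) glue_lab.
Proof.
have r := lab_lt l1 v1; have Q0 := lab_lt l2 v2; rewrite lab20 in Q0.
have shlt i : (i < Q.1)%N -> (sh i < (P.1 + Q.1).-1)%N by case: i => [|i] /=; lia.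
have big y : (P.1 <= P.1 + (lab2 y).-1)%N by rewrite leq_addr.
have PN a b : (P.1 <= a)%N || (P.1 <= b)%N -> adj P.2 a b = false.
  move=> ab; apply/negP => /(bounded_adj (lab_bounded l1))[].
  by rewrite !ltnNge => /negPf a' /negPf b'; rewrite a' b' in ab.
have QE i j : adj [seq (sh p.1, sh p.2) | p <- Q.2] (sh i) (sh j) = adj Q.2 i j.
  apply/idP/idP => [/adj_mapP[i' [j' [h /sh_inj-> /sh_inj->]]]//|]; exact: adj_map.
split.
- move=> [x|y] [x'|y'] //=.
  + by move/(lab_inj l1) => ->.
  + by move=> h; have := lab_lt l1 x; rewrite h ltnNge leq_addr.
  + by move=> h; have := lab_lt l1 x'; rewrite -h ltnNge leq_addr.
  + by rewrite !sh_lab2 => /sh_inj/(lab_inj l2)/val_inj ->.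
- case=> [x|y]; rewrite [glue_lab _]/=; first by have := lab_lt l1 x => /=; lia.
  by rewrite sh_lab2; apply: shlt; exact: lab_lt l2 _.
- move=> i /= ilt; have [iP|Pi] := ltnP i P.1.
    by have [x <-] := lab_onto l1 iP; exists (inl x).
  have /(lab_onto l2)[y yE] : ((i - P.1).+1 < Q.1)%N by lia.
  have yv : y != v2 by apply/eqP => h; rewrite h lab20 in yE.
  exists (inr (exist _ y yv)) => /=; rewrite yE /=; lia.
- rewrite /bounded all_cat; apply/andP; split.
    by apply: bounded_leq (lab_bounded l1) => /=; lia.
  apply/allP => _ /mapP[[i j] /(allP (lab_bounded l2)) /andP[/= il jl] ->] /=.
  by rewrite !shlt.
- have esE : (glue_pat P (lab1 v1) Q).2 = P.2 ++ [seq (sh p.1, sh p.2) | p <- Q.2] by [].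
  have esP a b := @adj_mapP sh Q.2 a b.
  move: [seq (sh p.1, sh p.2) | p <- Q.2] => es in QE esE esP *.
  rewrite esE => -[x|y] [x'|y'] /=; rewrite adj_cat.
  + rewrite -(lab_edge l1); case: edge => //=; apply/esym/negP.
    move=> /esP[i [j [ij xi xj]]].
    have i0 : i = 0%N by apply: sh0; rewrite -xi; exact: lab_lt.
    have j0 : j = 0%N by apply: sh0; rewrite -xj; exact: lab_lt.
    by move: ij; rewrite i0 j0 -lab20 -(lab_edge l2) edge_irrefl.
  + rewrite PN ?big ?orbT//= sh_lab2; apply/andP/idP => [[/eqP-> vy]|].
      by rewrite -[lab1 v1]/(sh 0) QE -lab20 -(lab_edge l2).
    move=> /esP[i [j [ij xi /sh_inj yj]]].
    have i0 : i = 0%N by apply: sh0; rewrite -xi; exact: lab_lt.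
    move: xi ij; rewrite i0 -yj -lab20 -(lab_edge l2) lab20 /=.
    by move=> /(lab_inj l1) ->.
  + rewrite PN ?big//= sh_lab2; apply/andP/idP => [[/eqP-> vy]|].
      by rewrite -[lab1 v1]/(sh 0) QE adjC -lab20 -(lab_edge l2).
    rewrite adjC => /esP[i [j [ij xi /sh_inj yj]]].
    have i0 : i = 0%N by apply: sh0; rewrite -xi; exact: lab_lt.
    move: xi ij; rewrite i0 -yj -lab20 -(lab_edge l2) lab20 /=.
    by move=> /(lab_inj l1) ->.
  + by rewrite PN ?big//= !sh_lab2 QE (lab_edge l2).
Qed.

Lemma glue_lab_inr y : y != v2 ->
  glue_lab (@glue_inr G1 v1 G2 v2 y) = (P.1 + (lab2 y).-1)%N.
Proof. by move=> yv; rewrite /glue_inr insubT. Qed.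

End glue_labels.

Definition labelled G P := exists lab, @labels G P lab.

Lemma labelled_cycle n : labelled (cycle_graph n.+3) (cycle_pat n.+3).
Proof. by eexists; exact: labels_cycle. Qed.

Lemma labelled_cc k l : labelled (cycle_cycle k.+3 l.+3) (cc_pat k.+3 l.+3).
Proof.
have := @labels_glue _ _ (ord0 : cycle_graph k.+3) (ord0 : cycle_graph l.+3)
  _ _ _ _ (labels_cycle k) (labels_cycle l) erefl.
by move=> h; eexists; exact: h.
Qed.

Lemma labelled_cpc k n l :
  labelled (cycle_path_cycle k.+3 n.+1 l.+3) (cpc_pat k.+3 n.+1 l.+3).
Proof.
have lkn := @labels_glue _ _ (ord0 : cycle_graph k.+3) (ord0 : path_graph n.+1)
  _ _ _ _ (labels_cycle k) (labels_path n.+1) erefl.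
have := @labels_glue _ _
  (@glue_inr (cycle_graph k.+3) ord0 (path_graph n.+1) ord0 ord_max)
  (ord0 : cycle_graph l.+3) _ _ _ _ lkn (labels_cycle l) erefl.
rewrite glue_lab_inr// => h; eexists; rewrite /cpc_pat addnS; exact: h.
Qed.

Section copies.
Variables (H G : sgraph) (P : pattern).
Hypothesis GP : labelled G P.

Lemma edges_pair A : A \in edges H -> exists a b, a != b /\ A = [set a; b]%SET.
Proof.
rewrite inE => /existsP[a /existsP[b /andP[ab /eqP->]]]; exists a, b; split=> //.
by apply: contraTneq ab => ->; rewrite edge_irrefl.
Qed.

Lemma copies_shape K : (0 < P.1)%N -> K \in copies H G ->
  K.2 \subset edges H /\ has_shape K.2 P.
Proof.
move=> P0; have [lab l] := GP; rewrite inE => /andP[/andP[sub /forall_inP in1]].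
move=> /existsP[f /and3P[/injectiveP f_inj /eqP fim /forallP fe]].
split=> //.
have [x0 _] := lab_onto l P0.
pose un i := odflt x0 [pick x | lab x == i].
have unK x : un (lab x) = x.
  rewrite /un; case: pickP => [y /eqP /(lab_inj l)//|/(_ x)]; by rewrite eqxx.
exists (f \o un) => [i j /(lab_onto l)[x <-] /(lab_onto l)[y <-]|A].
  by rewrite /= !unK => /f_inj ->.
apply/idP/mapP => [AK|[[i j] ij ->]].
  have [a [b [ab Aab]]] := edges_pair (fintype.subsetP sub _ AK).
  have /fintype.subsetP AK1 := in1 _ AK.
  have /imsetP[x _ xa] : a \in [set f x | x : G]%SET by rewrite fim AK1// Aab set21.
  have /imsetP[y _ yb] : b \in [set f x | x : G]%SET by rewrite fim AK1// Aab set22.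
  have /forallP/(_ y)/eqP := fe x; rewrite -xa -yb -Aab AK (lab_edge l) adjE.
  by case/orP => xy; [exists (lab x, lab y)|exists (lab y, lab x)];
    rewrite //= !unK -xa -yb// finset.setUC.
have /andP[/= /(lab_onto l)[x xi] /(lab_onto l)[y yj]] := allP (lab_bounded l) _ ij.
rewrite /= -xi -yj !unK; have /forallP/(_ y)/eqP <- := fe x.
by rewrite (lab_edge l) xi yj adjE ij.
Qed.

Lemma shape_copies (e : nat -> H) : inj_below P.1 e ->
  {subset edge_images e P.2 <= edges H} ->
  exists2 K, K \in copies H G & K.2 =i edge_images e P.2.
Proof.
move=> einj sub; have [lab l] := GP.
exists ([set e (lab x) | x : G]%SET, [set A in edge_images e P.2]%SET); last first.
  by move=> A; rewrite inE.
have images x : e (lab x) \in [set e (lab x) | x : G]%SET by exact: imset_f.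
rewrite inE; apply/andP; split; [apply/andP; split|].
- by apply/fintype.subsetP => A; rewrite inE => /sub.
- apply/forall_inP => A; rewrite inE => /mapP[[i j] ij ->] /=.
  have /andP[/= /(lab_onto l)[x xi] /(lab_onto l)[y yj]] := allP (lab_bounded l) _ ij.
  by rewrite -xi -yj; apply/fintype.subsetP => z; rewrite !inE => /orP[] /eqP->; exact: images.
- apply/existsP; exists [ffun x => e (lab x)]; apply/and3P; split.
  + apply/injectiveP => x y; rewrite !ffunE => /einj h; apply: (lab_inj l).
    by apply: h; exact: lab_lt l _.
  + by apply/eqP; apply: eq_imset => x; rewrite ffunE.
  + apply/forallP => x; apply/forallP => y; rewrite !ffunE inE.
    by rewrite (mem_edge_images einj (lab_bounded l) (lab_lt l x) (lab_lt l y)) (lab_edge l).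
Qed.

Lemma avoided_copies (F : {set {set H}}) : F \subset edges H ->
  ~ contains H G -> avoided F P.
Proof.
move=> /fintype.subsetP FE noG e einj sub.
by have [A /sub/FE|K Kc _] := shape_copies einj _; [|apply: noG; exists K].
Qed.

(** A copy of a graph without isolated vertices is determined by its edges. *)
Lemma card_copies : (0 < P.1)%N ->
  (forall i, (i < P.1)%N -> exists j, adj P.2 i j) ->
  #|copies H G| = #|[set F : {set {set H}} | (F \subset edges H) && `[< has_shape F P >]]%SET|.
Proof.
move=> P0 covered; have [lab l] := GP.
have cover_K K : K \in copies H G -> K.1 = finset.cover K.2.
  rewrite inE => /andP[/andP[sub /forall_inP in1]].
  move=> /existsP[f /and3P[_ /eqP fim /forallP fe]].
  apply/eqP; rewrite finset.eqEsubset; apply/andP; split; last exact/finset.bigcupsP.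
  rewrite -fim; apply/fintype.subsetP => _ /imsetP[x _ ->].
  have [j] := covered _ (lab_lt l x); move=> xj.
  have [y yj] := lab_onto l (bounded_adj (lab_bounded l) xj).2.
  have /forallP/(_ y)/eqP := fe x; rewrite (lab_edge l) yj xj => fxy.
  by apply/finset.bigcupP; exists [set f x; f y]%SET; rewrite ?set21.
rewrite -(card_in_imset (f := snd)); last first.
  move=> K K' Kc Kc' e2; rewrite [K]surjective_pairing [K']surjective_pairing.
  by rewrite (cover_K K)// (cover_K K')// e2.
apply: eq_card => F; rewrite inE; apply/imsetP/andP => [[K Kc ->]|[FE /asboolP[e einj eF]]].
  by have [KE Ks] := copies_shape P0 Kc; split=> //; exact/asboolP.
have [|K Kc KF] := shape_copies einj; first by move=> A; rewrite -eF => /(fintype.subsetP FE).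
by exists K => //; apply/setP => A; rewrite KF eF.
Qed.

End copies.

(** * The subgraphs that decide the sign *)

Lemma shape_card (V : finType) (F : {set {set V}}) (Q : pattern) :
  bounded Q.1 Q.2 -> simple Q.2 -> has_shape F Q -> #|F| = size Q.2.
Proof.
move=> bd sm [e einj eF].
by rewrite (eq_card eF) (card_uniqP (uniq_edge_images einj bd sm)) size_map.
Qed.

Lemma min_degree_or_pendant (V : finType) (F : {set {set V}}) :
  (forall A v, A \in F -> v \in A -> exists B, [/\ B \in F, B != A & v \in B]) \/
  exists A v, [/\ A \in F, v \in A & forall B, B \in F -> B != A -> v \notin B].
Proof.
have [h|] := boolP [forall A in F, forall v in A, exists B in F, (B != A) && (v \in B)].
  left=> A v AF vA; move/forall_inP/(_ A AF)/forall_inP/(_ v vA): h.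
  by case/exists_inP => B BF /andP[BA vB]; exists B.
rewrite negb_forall_in => /exists_inP[A AF]; rewrite negb_forall_in.
case/exists_inP => v vA; rewrite negb_exists_in => /forall_inP h.
by right; exists A, v; split=> // B BF BA; have := h B BF; rewrite BA.
Qed.

Section subgraph_sums.
Variable H : sgraph.
Implicit Types F : {set {set H}}.
Local Notation E := (edges H).
Hypothesis avoids : forall (F : {set {set H}}) Q, F \subset E ->
  Q \in even_cycles ++ excluded -> avoided F Q.

Context {R : realType} d (T : measurableType d) (P : probability T R) (x0 : T).
Variable U : T -> T -> R.
Hypothesis bU : bmfun (fun p : T * T => U p.1 p.2).
Hypothesis symU : forall x y, U x y = U y x.

Local Notation "''T'" := (Top P U).
Local Notation W := (closed_walk P U).
Local Notation C k := (cycle_density P U k).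
Local Notation pd := (pat_dens P x0 U).
Local Notation dens := (@dens R d T P U H).

(** Up to a positive factor, the coefficient of the [k]-th power of the size of
the perturbation. *)
Definition level k : R := \sum_(F : {set {set H}} | (F \subset E) && (#|F| == k)) dens F.

Let pairs (F : {set {set H}}) : F \subset E -> forall A, A \in F ->
  exists a b, a != b /\ A = [set a; b]%SET.
Proof. by move=> /fintype.subsetP FE A /FE; exact: edges_pair. Qed.

Lemma dens_pat F Q : bounded Q.1 Q.2 && simple Q.2 -> has_shape F Q ->
  dens F = pd Q.
Proof. by move=> /andP[bd sm]; exact: dens_shape. Qed.

(** An edge set with a vertex of degree one has density zero as soon as the
kernel has degree zero, and the others are found by the search. *)
Lemma dens_search F good : F \subset E -> F != finset.set0 ->
  all (fun Q => bounded Q.1 Q.2 && simple Q.2) good -> search good #|F| ->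
  inner P ('T (fun=> 1)) ('T (fun=> 1)) = 0 ->
  dens F = 0 \/ exists2 Q, Q \in good & has_shape F Q.
Proof.
move=> FE F0 wf sg T1; have [md|[A [v [AF vA pend]]]] := min_degree_or_pendant F.
  right; exact: (search_sound (pairs FE) md (fun Q => @avoids F Q FE) F0 wf sg).
by left; apply: (dens_pendant x0 bU symU (pairs FE) T1 AF vA pend).
Qed.

Lemma shape2 F : F \subset E -> #|F| = 2 ->
  has_shape F (path_pat 2) \/ has_shape F (union_pat (path_pat 1) (path_pat 1)).
Proof.
move=> FE /eqP/cards2P[A [B [AB FAB]]].
have [|a [b [ab Aab]]] := pairs FE (A := A); first by rewrite FAB set21.
have [|u [v [uv Buv]]] := pairs FE (A := B); first by rewrite FAB set22.
have path (x y z : H) : x != y -> z != y -> A = [set x; y]%SET -> B = [set y; z]%SET ->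
    has_shape F (path_pat 2).
  move=> xy zy Axy Byz.
  have us : uniq [:: x; y; z].
    rewrite /= !inE negb_or xy (eq_sym y) zy !andbT/=.
    by apply: contraNneq AB => xz; rewrite Axy Byz xz finset.setUC.
  exists (nth x [:: x; y; z]) => [i j i3 j3 /eqP|D].
    by rewrite nth_uniq// => /eqP.
  by rewrite /= FAB !inE Axy Byz.
have [au|au] := eqVneq a u.
  left; apply: (path b a v); rewrite ?Aab ?Buv ?au//.
  - by rewrite -au eq_sym.
  - by rewrite eq_sym.
  - by rewrite finset.setUC.
have [av|av] := eqVneq a v.
  left; apply: (path b a u); rewrite ?Aab ?Buv ?av// 1?finset.setUC//.
  by rewrite -av eq_sym.
have [bu|bu] := eqVneq b u.
  by left; apply: (path a b v); rewrite ?Aab ?Buv ?bu// -?bu// bu eq_sym.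
have [bv|bv] := eqVneq b v.
  by left; apply: (path a b u); rewrite ?Aab ?Buv ?bv// 1?finset.setUC// -bv.
right; have us : uniq [:: a; b; u; v].
  by rewrite /= !inE !negb_or ab au av bu bv uv.
exists (nth a [:: a; b; u; v]) => [i j i4 j4 /eqP|D].
  by rewrite nth_uniq// => /eqP.
by rewrite /= FAB !inE Aab Buv.
Qed.

(** Pairs of disjoint edges contribute a square, and pairs of adjacent edges the
squared norm of the degree function. *)
Lemma level2_gt0 F0 : F0 \subset E -> has_shape F0 (path_pat 2) ->
  0 < inner P ('T (fun=> 1)) ('T (fun=> 1)) -> 0 < level 2.
Proof.
move=> F0E F0s T1; have F02 : #|F0| = 2 by rewrite (shape_card _ _ F0s).
rewrite /level (bigD1 F0) ?F0E ?F02//=; apply: ltr_pwDl.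
  by rewrite (dens_pat _ F0s)// pat_dens_path2.
apply: sumr_ge0 => F /andP[/andP[FE /eqP F2] _].
have [s|s] := shape2 FE F2; rewrite (dens_pat _ s)//.
  by rewrite pat_dens_path2// ltW.
exact: pat_dens_path1_union.
Qed.

Hypothesis T1 : inner P ('T (fun=> 1)) ('T (fun=> 1)) = 0.

Let nonempty F k : #|F| = k.+1 -> F != finset.set0 :> {set {set H}}.
Proof. by move=> Fk; apply: contra_eq_neq Fk => ->; rewrite cards0. Qed.

Lemma level2 : level 2 = 0.
Proof.
apply: big1 => F /andP[FE /eqP F2].
have [|//|[]//] := @dens_search F [::] FE (nonempty F2) isT _ T1.
by rewrite F2 search2.
Qed.

Lemma level4 : level 4 = 0.
Proof.
apply: big1 => F /andP[FE /eqP F4].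
have [|//|[]//] := @dens_search F [::] FE (nonempty F4) isT _ T1.
by rewrite F4 search4.
Qed.

Lemma dens6 F : F \subset E -> #|F| = 6 ->
  dens F = 0 \/ has_shape F (union_pat (cycle_pat 3) (cycle_pat 3)).
Proof.
move=> FE F6; have [||[Q]] := @dens_search F shapes6 FE (nonempty F6) isT _ T1.
- by rewrite F6 search6.
- by left.
- by rewrite inE => /eqP -> s; right.
Qed.

Lemma pat_dens_C3C3 : pd (union_pat (cycle_pat 3) (cycle_pat 3)) = C 2 ^+ 2.
Proof. by rewrite pat_dens_triangle_union// pat_dens_C3// expr2. Qed.

Lemma level6_gt0 F0 : F0 \subset E ->
  has_shape F0 (union_pat (cycle_pat 3) (cycle_pat 3)) -> C 2 != 0 -> 0 < level 6.
Proof.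
move=> F0E F0s C2; have F06 : #|F0| = 6 by rewrite (shape_card _ _ F0s).
rewrite /level (bigD1 F0) ?F0E ?F06//=; apply: ltr_pwDl.
  by rewrite (dens_pat _ F0s)// pat_dens_C3C3 exprn_even_gt0.
apply: sumr_ge0 => F /andP[/andP[FE /eqP F6] _].
have [->//|s] := dens6 FE F6.
by rewrite (dens_pat _ s)// pat_dens_C3C3 sqr_ge0.
Qed.

Hypothesis C3 : C 2 = 0.

Lemma level6 : level 6 = 0.
Proof.
apply: big1 => F /andP[FE /eqP F6]; have [//|s] := dens6 FE F6.
by rewrite (dens_pat _ s)// pat_dens_C3C3 C3 expr0n.
Qed.

Lemma level8 : level 8 = 0.
Proof.
apply: big1 => F /andP[FE /eqP F8].
have [||[Q]] := @dens_search F shapes8 FE (nonempty F8) isT _ T1.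
- by rewrite F8 search8.
- by [].
rewrite inE => /eqP -> s.
by rewrite (dens_pat _ s)// pat_dens_triangle_union// C3 mul0r.
Qed.

(** The other sets of ten edges that count are decagons and pairs of disjoint
pentagons, as a component that is a triangle makes the density vanish. *)
Lemma dens10 F : F \subset E -> #|F| = 10 ->
  [\/ has_shape F (cpc_pat 3 4 3), has_shape F (cpc_pat 3 2 5),
      has_shape F (cc_pat 5 5) | 0 <= dens F <= C 9 + C 4 ^+ 2].
Proof.
move=> FE F10; have C9 : 0 <= C 9 by exact: (cycle_density_ge0 P bU symU 4).
have C4 : 0 <= C 4 ^+ 2 by exact: sqr_ge0.
have ok : 0 <= (0 : R) <= C 9 + C 4 ^+ 2 by rewrite lexx addr_ge0.
have [||[Q]] := @dens_search F shapes10 FE (nonempty F10) isT _ T1.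
- by rewrite F10 search10.
- by move=> ->; apply: Or44.
rewrite !inE => + s; move: (s) => /dens_pat sQ.
case/or4P => [|||/or4P[]] /eqP QE; rewrite {Q}QE in s sQ.
- exact: Or42.
- exact: Or41.
- exact: Or43.
- by apply: Or44; rewrite sQ// pat_dens_C10// C9 lerDl.
- by apply: Or44; rewrite sQ// pat_dens_triangle_union// C3 mul0r.
- apply: Or44; rewrite sQ// pat_dens_pentagon_union// pat_dens_C5// -expr2.
  by rewrite C4 lerDr.
- by apply: Or44; rewrite sQ// pat_dens_triangle_union// C3 mul0r.
Qed.

Definition shaped Q : {set {set {set H}}} :=
  [set F : {set {set H}} | (F \subset E) && `[< has_shape F Q >]]%SET.

Hypothesis disjoint_shapes : forall F Q Q',
  Q \in [:: cpc_pat 3 4 3; cpc_pat 3 2 5; cc_pat 5 5; cycle_pat 10] ->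
  Q' \in [:: cpc_pat 3 4 3; cpc_pat 3 2 5; cc_pat 5 5; cycle_pat 10] ->
  has_shape F Q -> has_shape F Q' -> Q = Q'.

Let sum_shaped Q (D : pred {set {set H}}) :
  bounded Q.1 Q.2 && simple Q.2 -> size Q.2 = 10 ->
  (forall F, F \in shaped Q -> D F) ->
  \sum_(F : {set {set H}} | [&& F \subset E, #|F| == 10, D F & F \in shaped Q]) dens F =
  #|shaped Q|%:R * pd Q.
Proof.
move=> wf sz DF; rewrite (eq_bigl [in shaped Q])/=; last first.
  move=> F; case: (boolP (F \in shaped Q)) => FQ; last by rewrite !andbF.
  rewrite DF//; move: FQ; rewrite inE => /andP[-> /asboolP s].
  by have /andP[bd sm] := wf; rewrite (shape_card bd sm s) sz.
rewrite (eq_bigr (fun=> pd Q)); first by rewrite sumr_const mulr_natl.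
by move=> F; rewrite inE => /andP[_ /asboolP s]; exact: dens_pat.
Qed.

Definition rest10 : R := \sum_(F : {set {set H}} |
  [&& F \subset E, #|F| == 10, F \notin shaped (cpc_pat 3 4 3),
      F \notin shaped (cpc_pat 3 2 5) & F \notin shaped (cc_pat 5 5)]) dens F.

Lemma level10 : level 10 =
  #|shaped (cpc_pat 3 4 3)|%:R * pd (cpc_pat 3 4 3) +
  #|shaped (cpc_pat 3 2 5)|%:R * pd (cpc_pat 3 2 5) +
  #|shaped (cc_pat 5 5)|%:R * pd (cc_pat 5 5) + rest10.
Proof.
have dis Q Q' : Q \in [:: cpc_pat 3 4 3; cpc_pat 3 2 5; cc_pat 5 5] ->
    Q' \in [:: cpc_pat 3 4 3; cpc_pat 3 2 5; cc_pat 5 5] -> Q != Q' ->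
    forall F, F \in shaped Q -> F \notin shaped Q'.
  move=> Qin Q'in QQ' F; rewrite !inE => /andP[FE /asboolP s]; rewrite FE.
  apply/asboolP => s'; case/eqP: QQ'; apply: disjoint_shapes s s'.
    by move: Qin; rewrite !inE => /or3P[] ->; rewrite ?orbT.
  by move: Q'in; rewrite !inE => /or3P[] ->; rewrite ?orbT.
rewrite /level (bigID [in shaped (cpc_pat 3 4 3)])/= -!addrA; congr (_ + _).
  rewrite -(sum_shaped (D := xpredT))//; apply: eq_bigl => F.
  by rewrite andTb andbA.
rewrite (bigID [in shaped (cpc_pat 3 2 5)])/=; congr (_ + _).
  rewrite -(sum_shaped (D := [pred F | F \notin shaped (cpc_pat 3 4 3)]))//.
    by apply: eq_bigl => F; rewrite /= -!andbA.
  by move=> F; apply: dis; rewrite ?inE.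
rewrite (bigID [in shaped (cc_pat 5 5)])/=; congr (_ + _); last first.
  by apply: eq_bigl => F; rewrite -!andbA.
rewrite -(sum_shaped (D := [pred F | (F \notin shaped (cpc_pat 3 4 3)) &&
  (F \notin shaped (cpc_pat 3 2 5))]))//.
  by apply: eq_bigl => F; rewrite /= -!andbA.
by move=> F Fs; rewrite /= !(dis (cc_pat 5 5)).
Qed.

Let rest_dens F : [&& F \subset E, #|F| == 10, F \notin shaped (cpc_pat 3 4 3),
      F \notin shaped (cpc_pat 3 2 5) & F \notin shaped (cc_pat 5 5)] ->
  0 <= dens F <= C 9 + C 4 ^+ 2.
Proof.
move=> /and5P[FE /eqP F10]; rewrite !inE FE /=.
move=> /asboolP s1 /asboolP s2 /asboolP s3.
by have [] := dens10 FE F10.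
Qed.

Lemma rest10_ge F0 : F0 \subset E -> has_shape F0 (cycle_pat 10) -> C 9 <= rest10.
Proof.
move=> F0E s0; have F010 : #|F0| = 10 by rewrite (shape_card _ _ s0).
rewrite /rest10 (bigD1 F0)/=; last first.
  rewrite F0E F010 eqxx /= !inE F0E /=.
  by apply/and3P; split; apply/asboolP => s;
    have := disjoint_shapes _ _ s0 s; rewrite !inE => /(_ isT isT).
rewrite (dens_pat _ s0)// pat_dens_C10// lerDl.
by apply: sumr_ge0 => F /andP[/rest_dens/andP[]].
Qed.

Lemma rest10_le : rest10 <= #|{: {set {set H}}}|%:R * (C 9 + C 4 ^+ 2).
Proof.
rewrite mulr_natl -sumr_const /rest10 big_mkcond [leRHS]big_mkcond/=.
apply: ler_sum => F _; case: ifPn => [/rest_dens/andP[]//|_].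
rewrite addr_ge0 ?sqr_ge0//; exact: (cycle_density_ge0 P bU symU 4).
Qed.

End subgraph_sums.

(** * Kernels of finite rank *)

Section finite_rank.
Context {R : realType} d (T : measurableType d) (P : probability T R).
Variables (A : finType) (e : A -> T -> R) (lam : A -> R).
Hypothesis be : forall a, bmfun (e a).
Hypothesis orth : forall a b, inner P (e a) (e b) = (a == b)%:R.

(** The functions [e a] are orthonormal eigenfunctions, with eigenvalues
[lam a]. *)
Definition rank_kernel (x y : T) : R := \sum_a lam a * e a x * e a y.

Lemma bmfun_rank_kernel : bmfun (fun p : T * T => rank_kernel p.1 p.2).
Proof.
apply: bmfun_sum => a _; apply: bmfunM; first apply: bmfunZ.
  exact: (bmfun_comp (@measurable_fst _ _ T T) (be a)).
exact: (bmfun_comp (@measurable_snd _ _ T T) (be a)).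
Qed.

Lemma rank_kernel_sym x y : rank_kernel x y = rank_kernel y x.
Proof. by apply: eq_bigr => a _; rewrite mulrAC. Qed.

Lemma Top_rank f : bmfun f ->
  Top P rank_kernel f = fun x => \sum_a lam a * inner P (e a) f * e a x.
Proof.
move=> bf; apply/funext => x; rewrite /Top.
transitivity (\int[P]_y \sum_a (lam a * e a x) * (e a y * f y)).
  by apply: eq_Rint => y; rewrite /rank_kernel mulr_suml; apply: eq_bigr => a _; ring.
rewrite Rint_sum => [|a _]; last by apply: bmfunZ; exact: bmfunM.
apply: eq_bigr => a _; rewrite RintZ; last exact: bmfunM.
by rewrite /inner; ring.
Qed.

Lemma Top_comb (c : A -> R) :
  Top P rank_kernel (fun x => \sum_a c a * e a x) =
  fun x => \sum_a (lam a * c a) * e a x.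
Proof.
rewrite Top_rank; last by apply: bmfun_sum => a _; exact: bmfunZ.
apply/funext => x; apply: eq_bigr => a _; congr (_ * _ * _).
transitivity (\sum_b c b * inner P (e a) (e b)).
  rewrite /inner; transitivity (\int[P]_y \sum_b c b * (e a y * e b y)).
    by apply: eq_Rint => y; rewrite mulr_sumr; apply: eq_bigr => b _; ring.
  rewrite Rint_sum => [|b _]; last by apply: bmfunZ; exact: bmfunM.
  by apply: eq_bigr => b _; rewrite RintZ//; exact: bmfunM.
rewrite (bigD1 a)//= orth eqxx mulr1 big1 ?addr0// => b ba.
by rewrite orth eq_sym (negPf ba) mulr0.
Qed.

Lemma iter_comb k (c : A -> R) :
  iter k (Top P rank_kernel) (fun x => \sum_a c a * e a x) =
  fun x => \sum_a (lam a ^+ k * c a) * e a x.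
Proof.
elim: k => [|k IHk] /=.
  by apply/funext => x; apply: eq_bigr => a _; rewrite expr0 mul1r.
rewrite IHk Top_comb; apply/funext => x; apply: eq_bigr => a _.
by rewrite exprS mulrA.
Qed.

Lemma iter_eigen k c a :
  iter k (Top P rank_kernel) (fun x => c * e a x) = fun x => (lam a ^+ k * c) * e a x.
Proof.
have comb c' : (fun x => c' * e a x) = (fun x => \sum_b (if b == a then c' else 0) * e b x).
  apply/funext => x; rewrite (bigD1 a)//= eqxx big1 ?addr0// => b /negPf ->.
  by rewrite mul0r.
rewrite comb iter_comb comb; apply/funext => x; apply: eq_bigr => b _.
by case: eqP => [->|]//; rewrite mulr0.
Qed.

Lemma closed_walk_rank k x :
  closed_walk P rank_kernel k x = \sum_a lam a ^+ k.+1 * e a x ^+ 2.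
Proof.
rewrite /closed_walk -[rank_kernel x]/(fun y => \sum_a lam a * e a x * e a y).
rewrite iter_comb; apply: eq_bigr => a _; rewrite exprS; ring.
Qed.

Lemma cycle_density_rank k :
  cycle_density P rank_kernel k = \sum_a lam a ^+ k.+1.
Proof.
transitivity (\int[P]_x \sum_a lam a ^+ k.+1 * (e a x * e a x)).
  by apply: eq_Rint => x; rewrite closed_walk_rank; apply: eq_bigr => a _; rewrite expr2.
rewrite Rint_sum => [|a _]; last by apply: bmfunZ; exact: bmfunM.
apply: eq_bigr => a _; rewrite RintZ; last exact: bmfunM.
by rewrite -[\int[P]_x _]/(inner P (e a) (e a)) orth eqxx mulr1.
Qed.

End finite_rank.

(** * Independent signs on the unit interval *)

Section cells.
Variable R : realType.
Local Notation TR := (measurableTypeR R).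
Local Notation P := (lebesgue01 R).

(** The index of the part of the unit interval, cut into equal parts, that
contains a point.  Points outside of the interval, and its right end, go to
the nearest part, which keeps the index defined everywhere. *)
Definition cell N (x : R) : 'I_N.+1 := inord (minn (Num.truncn (x * N.+1%:R)) N).

Lemma cellE N x : cell N x = minn (Num.truncn (x * N.+1%:R)) N :> nat.
Proof. by rewrite inordK// ltnS geq_minr. Qed.

Lemma bmfun_cell_le N j : bmfun (fun x : TR => (cell N x <= j)%N%:R : R).
Proof.
have [Nj|jN] := leqP N j.
  apply: (@eq_bmfun _ _ _ (fun=> 1)); last exact: bmfun_cst.
  by move=> x; rewrite cellE geq_min Nj orbT.
apply: (@eq_bmfun _ _ _ (\1_[set x : TR | x * N.+1%:R < j.+1%:R])).
  move=> x; rewrite indicE cellE geq_min (leqNgt N) jN orbF truncn_le_nat.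
  by rewrite mem_setE.
split; last by exists 1 => x; rewrite indicE; case: (_ \in _); rewrite ?normr1 ?normr0.
apply/measurable_indicP.
rewrite (_ : [set x | _] = `]-oo, (j.+1%:R / N.+1%:R)[%classic).
  exact: measurable_itv.
by apply/seteqP; split => x /=; rewrite in_itv/= ltr_pdivlMr// ltr0n.
Qed.

Lemma bmfun_cell_eq N (i : 'I_N.+1) : bmfun (fun x : TR => (cell N x == i)%:R : R).
Proof.
have [i0|i0] := posnP i.
  apply: (@eq_bmfun _ _ _ _ _ _ (bmfun_cell_le N 0)) => x.
  by rewrite leqn0 -val_eqE /= i0.
apply: (@eq_bmfun _ _ _ (fun x => (cell N x <= i)%N%:R + (-1) * (cell N x <= i.-1)%N%:R)).
  move=> x; rewrite -val_eqE /=; case: ltngtP => [ltx|gtx|->].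
  - by rewrite -ltnS prednK// ltx mulN1r subrr.
  - by rewrite leqNgt (leq_ltn_trans (leq_pred i) gtx)/= mulr0 addr0.
  - by rewrite leqNgt prednK// leqnn mulr0 addr0.
by apply: bmfunD; [|apply: bmfunZ]; exact: bmfun_cell_le.
Qed.

Lemma cell_sum N (h : 'I_N.+1 -> R) x :
  h (cell N x) = \sum_i h i * (cell N x == i)%:R.
Proof.
rewrite (bigD1 (cell N x))//= eqxx mulr1 big1 ?addr0// => i.
by rewrite eq_sym => /negPf ->; rewrite mulr0.
Qed.

Lemma bmfun_cell N (h : 'I_N.+1 -> R) : bmfun (fun x : TR => h (cell N x)).
Proof.
apply: (@eq_bmfun _ _ _ (fun x => \sum_i h i * (cell N x == i)%:R)).
  by move=> x; rewrite -cell_sum.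
by apply: bmfun_sum => i _; apply: bmfunZ; exact: bmfun_cell_eq.
Qed.

(** Each cell has at least its length as measure, and the measures add up to
one. *)
Lemma Rint_cell_eq N (i : 'I_N.+1) :
  \int[P]_x ((cell N x == i)%:R : R) = N.+1%:R^-1.
Proof.
pose p j : R := \int[P]_x ((cell N x == j)%:R : R).
have p1 : \sum_j p j = 1.
  rewrite -Rint_sum => [|j _]; last exact: bmfun_cell_eq.
  rewrite -[RHS](Rint_cst P); apply: eq_Rint => x.
  by rewrite -[RHS]/((fun=> 1) (cell N x)) cell_sum; apply: eq_bigr => j _; rewrite mul1r.
have N0 : 0 < N.+1%:R :> R by rewrite ltr0n.
have pge j : N.+1%:R^-1 <= p j.
  pose J : set TR := `[j%:R / N.+1%:R, j.+1%:R / N.+1%:R[%classic.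
  have mJ : measurable J by exact: measurable_itv.
  have bJ : bmfun (\1_J : TR -> R).
    split; first exact/measurable_indicP.
    by exists 1 => x; rewrite indicE; case: (_ \in _); rewrite ?normr1 ?normr0.
  apply: (@le_trans _ _ (\int[P]_x \1_J x)); last first.
    apply: le_Rint => //; first exact: bmfun_cell_eq.
    move=> x; rewrite indicE; case: (boolP (x \in J)) => [|_]; last exact: ler0n.
    move/set_mem; rewrite /J /= in_itv /= ler_pdivrMr// ltr_pdivlMr// => xj.
    rewrite -val_eqE /= cellE (truncn_def xj).
    by rewrite (minn_idPl _) ?eqxx// -ltnS.
  rewrite /Rintegral [X in fine X](_ : _ = lebesgue_measure (J `&` `[0, 1])); last first.
    by rewrite integral_indic// setIT; exact: lebesgue01E.
  have -> : J `&` `[0, 1] = J.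
    apply/setIidPl => x; rewrite /J /= !in_itv /= => /andP[jx xj].
    rewrite (le_trans _ jx) ?divr_ge0//= (le_trans (ltW xj))//.
    by rewrite ler_pdivrMr// mul1r ler_nat.
  rewrite lebesgue_measure_itv /= lte_fin ltr_pM2r ?invr_gt0// ltr_nat ltnSn.
  by rewrite -EFinB /= -mulrBl -natrB// subSnn mul1r.
have : \sum_j (p j - N.+1%:R^-1) = 0.
  by rewrite sumrB p1 sumr_const card_ord -[_ *+ _]mulr_natr mulVf ?subrr// gt_eqF.
move/psumr_eq0P => h; apply/eqP; rewrite -subr_eq0; apply/eqP; apply: h => // j _.
by rewrite subr_ge0.
Qed.

Lemma Rint_cell N (h : 'I_N.+1 -> R) :
  \int[P]_x h (cell N x) = N.+1%:R^-1 * \sum_i h i.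
Proof.
transitivity (\int[P]_x \sum_i h i * (cell N x == i)%:R).
  by apply: eq_Rint => x; rewrite -cell_sum.
rewrite Rint_sum => [|i _]; last first.
  by apply: bmfunZ; exact: bmfun_cell_eq.
rewrite mulr_sumr; apply: eq_bigr => i _.
by rewrite RintZ ?Rint_cell_eq 1?mulrC//; exact: bmfun_cell_eq.
Qed.

End cells.

Section signs.
Variables (R : realType) (I : finType).
Local Notation TR := (measurableTypeR R).
Local Notation P := (lebesgue01 R).

Lemma card_signs : #|{set I}|.-1.+1 = #|{set I}|.
Proof. by rewrite prednK//; apply/card_gt0P; exists finset.set0. Qed.

(** Under the uniform measure all subsets of [I] are equally likely, so that
the elements of [I] give independent fair coins. *)
Definition pattern_of (x : R) : {set I} :=
  enum_val (cast_ord card_signs (cell #|{set I}|.-1 x)).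

Lemma bmfun_pattern (h : {set I} -> R) : bmfun (fun x : TR => h (pattern_of x)).
Proof. exact: (bmfun_cell (fun i => h (enum_val (cast_ord card_signs i)))). Qed.

Lemma Rint_pattern (h : {set I} -> R) :
  \int[P]_x h (pattern_of x) = #|{set I}|%:R^-1 * \sum_S h S.
Proof.
rewrite (Rint_cell (fun i => h (enum_val (cast_ord card_signs i)))).
congr (_ * _); first by congr (_%:R^-1); exact: card_signs.
rewrite [RHS](reindex (fun i => enum_val (cast_ord card_signs i)))//.
exists (fun S => cast_ord (esym card_signs) (enum_rank S)) => [i _|S _].
  by rewrite enum_valK cast_ordK.
by rewrite cast_ordKV enum_rankK.
Qed.

Definition sign (i : I) (x : R) : R := if i \in pattern_of x then -1 else 1.

Lemma bmfun_sign i : bmfun (sign i : TR -> R).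
Proof. exact: (bmfun_pattern (fun S => if i \in S then -1 else 1)). Qed.

Lemma sign_sqr i x : sign i x * sign i x = 1.
Proof. by rewrite /sign; case: ifP; rewrite ?mulrNN mulr1. Qed.

Definition flip (i : I) (S : {set I}) : {set I} :=
  [set j | (j \in S) (+) (j == i)]%SET.

Lemma flipK i : involutive (flip i).
Proof. by move=> S; apply/setP => j; rewrite !inE addbK. Qed.

(** Flipping a sign preserves the measure, and changes the sign of the
integrand. *)
Lemma Rint_sign i (h : {set I} -> R) : (forall S, h (flip i S) = h S) ->
  \int[P]_x (sign i x * h (pattern_of x)) = 0.
Proof.
move=> hi; pose g (S : {set I}) := (if i \in S then -1 else 1) * h S : R.
rewrite -[LHS]/(\int[P]_x g (pattern_of x)) Rint_pattern.
suff -> : \sum_S g S = 0 by rewrite mulr0.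
have : \sum_S g S = - \sum_S g S.
  rewrite {1}(reindex_inj (inv_inj (flipK i))) /= -sumrN.
  apply: eq_bigr => S _; rewrite /g hi inE eqxx addbT.
  by case: (i \in S); rewrite /= mulN1r ?mul1r ?opprK.
by move/eqP; rewrite -subr_eq0 opprK -mulr2n mulrn_eq0 /= => /eqP.
Qed.

Lemma sign_flip i j (S : {set I}) : i != j ->
  (if i \in flip j S then -1 else 1 : R) = (if i \in S then -1 else 1).
Proof. by move=> ij; rewrite inE (negPf ij) addbF. Qed.

End signs.

(** * The test kernel *)

(** The kernel has eigenfunctions [phi] and [psi], with opposite eigenvalues,
and for each [j] two functions carried by [phi = 1] and by [phi = -1], again
with opposite eigenvalues.  All eigenvalues cancel in pairs, so odd cycles
have density zero.  Triangles and pentagons at a point, however, are constant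
multiples of [phi].  Among the eigenvalues on [phi = 1], [1] is taken sixteen
times as often as [-2]: as [16 - 8] and [16 - 32] have opposite signs, so do
the two multiples.  The eigenvalue of [phi] sets the weight of a path between
two cycles, and [k] makes the products of two local densities, which grow
quadratically, dominate the decagons, which grow linearly. *)
Section test_kernel.
Variables (R : realType) (k : nat) (m : R).
Hypothesis m0 : 0 <= m.
Local Notation TR := (measurableTypeR R).
Local Notation P := (lebesgue01 R).

Definition modes : finType := ('I_k * 'I_17)%type.
Definition signs : finType := (bool + modes)%type.

Definition phi (x : R) : R := sign (inl true : signs) x.
Definition psi (x : R) : R := sign (inl false : signs) x.
Definition chi (j : modes) (x : R) : R := sign (inr j : signs) x.

Definition mode_index : finType := (bool + modes * bool)%type.

Definition mode (a : mode_index) (x : R) : R :=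
  match a with
  | inl b => if b then phi x else psi x
  | inr (j, b) => (Num.sqrt 2)^-1 * (chi j x * (1 + (-1) ^+ b * phi x))
  end.

Definition mode_val (a : mode_index) : R :=
  match a with
  | inl b => (-1) ^+ b * - Num.sqrt m
  | inr (j, b) => (-1) ^+ b * (if j.2 == ord_max then - 2 else 1)
  end.

Lemma bmfun_mode a : bmfun (mode a : TR -> R).
Proof.
case: a => [[]|[j b]] /=; [exact: bmfun_sign..|].
apply: bmfunZ; apply: bmfunM; first exact: bmfun_sign.
by apply: bmfunD; [exact: bmfun_cst|apply: bmfunZ; exact: bmfun_sign].
Qed.

Let s2 : (Num.sqrt 2)^-1 * (Num.sqrt 2)^-1 = 2^-1 :> R.
Proof. by rewrite -invfM -expr2 sqr_sqrtr. Qed.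

Let Rint0 (f : TR -> R) (i : signs) (h : {set signs} -> R) :
  (forall S, h (flip i S) = h S) -> (forall x, f x = sign i x * h (pattern_of signs x)) ->
  \int[P]_x f x = 0.
Proof. by move=> hi fE; rewrite (eq_Rint _ fE) Rint_sign. Qed.

Let sg (i : signs) (S : {set signs}) : R := if i \in S then -1 else 1.

Let sgE i x : sg i (pattern_of signs x) = sign i x.
Proof. by []. Qed.

Lemma mode_orth a b : inner P (mode a) (mode b) = (a == b)%:R.
Proof.
rewrite /inner; case: a b => [a|[i a]] [b|[j b]].
- rewrite (_ : (inl a == inl b) = (a == b)) //.
  case: eqVneq => [->|ab].
    rewrite -[RHS](Rint_cst P); apply: eq_Rint => x.
    by rewrite /mode; case: b; exact: sign_sqr.
  apply: (@Rint0 _ (inl a) (sg (inl b))) => [S|x]; first by rewrite /sg sign_flip// eq_sym.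
  by case: a b ab => -[].
- apply: (@Rint0 _ (inr j) (fun S => (Num.sqrt 2)^-1 * sg (inl a) S *
    (1 + (-1) ^+ b * sg (inl true) S))) => [S|x]; first by rewrite /sg !sign_flip.
  by rewrite !sgE; case: a; rewrite /mode /chi /phi /psi; ring.
- apply: (@Rint0 _ (inr i) (fun S => (Num.sqrt 2)^-1 * sg (inl b) S *
    (1 + (-1) ^+ a * sg (inl true) S))) => [S|x]; first by rewrite /sg !sign_flip.
  by rewrite !sgE; case: b; rewrite /mode /chi /phi /psi; ring.
have [->|ij] := eqVneq i j; last first.
  rewrite (_ : (_ == _) = false); last by apply/negbTE; apply: contraNneq ij => -[->].
  apply: (@Rint0 _ (inr i) (fun S => 2^-1 * sg (inr j) S *
    (1 + (-1) ^+ a * sg (inl true) S) * (1 + (-1) ^+ b * sg (inl true) S))) => [S|x].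
    by rewrite /sg !sign_flip// eq_sym.
  by rewrite !sgE -s2 /mode /chi /phi; ring.
rewrite (_ : (_ == _) = (a == b)); last by apply/eqP/eqP => [[]|->].
transitivity (\int[P]_x ((a == b)%:R + (((-1) ^+ a + (-1) ^+ b) / 2) * phi x)).
  apply: eq_Rint => x; rewrite /mode mulrACA s2 mulrACA [chi j x * _]sign_sqr mul1r.
  have := sign_sqr (inl true : signs) x; rewrite -/(phi x) => p2.
  rewrite (_ : _ * _ = 2^-1 * (1 + (-1) ^+ a * (-1) ^+ b * (phi x * phi x) +
     ((-1) ^+ a + (-1) ^+ b) * phi x)); last by ring.
  by rewrite p2; case: a b => -[] /=; rewrite ?expr0 ?expr1; field.
rewrite RintD; [|exact: bmfun_cst|by apply: bmfunZ; exact: bmfun_sign].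
rewrite Rint_cst RintZ; last exact: bmfun_sign.
rewrite (@Rint0 phi (inl true) (fun=> 1)) ?mulr0 ?addr0// => x.
by rewrite mulr1.
Qed.

Lemma mode_mean a : \int[P]_x mode a x = 0.
Proof.
case: a => [[]|[j b]] /=.
- by apply: (@Rint0 _ (inl true) (fun=> 1)) => // x; rewrite mulr1.
- by apply: (@Rint0 _ (inl false) (fun=> 1)) => // x; rewrite mulr1.
apply: (@Rint0 _ (inr j) (fun S => (Num.sqrt 2)^-1 * (1 + (-1) ^+ b * sg (inl true) S))).
  by move=> S; rewrite /sg sign_flip.
by move=> x; rewrite sgE /chi /phi; ring.
Qed.

Definition test_kernel : R -> R -> R := rank_kernel mode mode_val.

Lemma sum_modes (f : R -> R) :
  \sum_(j : modes) f (if j.2 == ord_max then - 2 else 1) =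
  k%:R * (16 * f 1 + f (- 2)).
Proof.
rewrite -(pair_bigA _ (fun _ i => f (if i == ord_max then - 2 else 1)))/=.
rewrite sumr_const card_ord -[LHS]mulr_natl; congr (_ * _).
rewrite big_ord_recr eqxx; congr (_ + _).
rewrite (eq_bigr (fun=> f 1)); last first.
  by move=> i _; rewrite -val_eqE /= ltn_eqF.
by rewrite sumr_const card_ord mulr_natl.
Qed.

Lemma sum_mode_index (F : mode_index -> R) :
  \sum_a F a = F (inl true) + F (inl false) +
    \sum_(j : modes) (F (inr (j, false)) + F (inr (j, true))).
Proof.
rewrite big_sumType/= big_bool; congr (_ + _).
rewrite (eq_bigr (fun p => F (inr (p.1, p.2)))); last by case.
rewrite -(pair_bigA _ (fun j b => F (inr (j, b))))/=.
by apply: eq_bigr => j _; rewrite big_bool addrC.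
Qed.

Lemma test_closed_walk n x :
  closed_walk P test_kernel n.*2 x = 2 * k%:R * (16 + (- 2) ^+ n.*2.+1) * phi x.
Proof.
have odd1 : (-1) ^+ n.*2.+1 = -1 :> R by rewrite -signr_odd /= odd_double.
rewrite (closed_walk_rank mode_val bmfun_mode mode_orth) sum_mode_index /mode /mode_val.
have p2 : phi x ^+ 2 = 1 by rewrite expr2 sign_sqr.
have q2 : psi x ^+ 2 = 1 by rewrite expr2 sign_sqr.
rewrite p2 q2 expr0 expr1 mul1r mulN1r opprK [(- Num.sqrt m) ^+ _]exprNn odd1.
rewrite !mulr1 mulN1r subrr add0r.
transitivity (\sum_(j : modes)
    (fun t => 2 * phi x * t ^+ n.*2.+1) (if j.2 == ord_max then - 2 else 1)).
  apply: eq_bigr => j _; set t := if _ then _ else _.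
  have c2 : chi j x ^+ 2 = 1 by rewrite expr2 sign_sqr.
  have r2 : (Num.sqrt 2)^-1 ^+ 2 = 2^-1 :> R by rewrite expr2.
  rewrite ?mul1r ?mulN1r exprNn odd1 mulN1r !exprMn r2 c2.
  transitivity (2^-1 * t ^+ n.*2.+1 * ((1 + phi x) ^+ 2 - (1 - phi x) ^+ 2)).
    by ring.
  by field.
rewrite (sum_modes (fun t => 2 * phi x * t ^+ n.*2.+1)) expr1n; ring.
Qed.

Lemma test_cycle n : cycle_density P test_kernel n.*2 = 0.
Proof.
rewrite /cycle_density (eq_Rint _ (test_closed_walk n)) RintZ; last exact: bmfun_sign.
by rewrite (mode_mean (inl true)) mulr0.
Qed.

Lemma test_C10 : cycle_density P test_kernel 9 = 2 * m ^+ 5 + 2080 * k%:R.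
Proof.
rewrite (cycle_density_rank mode_val bmfun_mode mode_orth) sum_mode_index /mode_val.
have sgn (b : bool) (t : R) : ((-1) ^+ b * t) ^+ 10 = t ^+ 10.
  by case: b; rewrite ?expr0 ?expr1; ring.
have sm : (- Num.sqrt m) ^+ 10 = m ^+ 5.
  by rewrite -[in RHS](sqr_sqrtr m0); ring.
rewrite !sgn sm (eq_bigr (fun j : modes =>
    (fun t => 2 * t ^+ 10) (if j.2 == ord_max then - 2 else 1))).
  by rewrite (sum_modes (fun t => 2 * t ^+ 10)); ring.
by move=> j _; rewrite !sgn; ring.
Qed.

Lemma test_degree : inner P (Top P test_kernel (fun=> 1)) (Top P test_kernel (fun=> 1)) = 0.
Proof.
have -> : Top P test_kernel (fun=> 1) = fun=> 0.
  rewrite (Top_rank P mode_val bmfun_mode); last exact: bmfun_cst.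
  apply/funext => x; apply: big1 => a _.
  rewrite (_ : inner _ _ _ = 0) ?mulr0 ?mul0r//.
  by rewrite -(mode_mean a); apply: eq_Rint => y; rewrite mulr1.
by rewrite -[RHS](Rint_cst P); apply: eq_Rint => x; rewrite mul0r.
Qed.

Lemma test_Top2 : iter 2 (Top P test_kernel) (closed_walk P test_kernel 2) =
  fun x => (m * (16 * k%:R)) * phi x.
Proof.
have -> : closed_walk P test_kernel 2 = fun x => (16 * k%:R) * mode (inl true) x.
  by apply/funext => x; rewrite (test_closed_walk 1)/=; ring.
rewrite (iter_eigen mode_val bmfun_mode mode_orth)/= expr1 mulN1r opprK sqr_sqrtr//.
Qed.

Let phi2 c d : inner P (fun x => c * phi x) (fun x => d * phi x) = c * d.
Proof.
rewrite -[RHS](Rint_cst P); apply: eq_Rint => x.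
by rewrite mulrACA sign_sqr mulr1.
Qed.

Let W4 : closed_walk P test_kernel 4 = fun x => (- 32 * k%:R) * phi x.
Proof. by apply/funext => x; rewrite (test_closed_walk 2)/=; ring. Qed.

Lemma bmfun_test : bmfun (fun p : TR * TR => test_kernel p.1 p.2).
Proof. exact: bmfun_rank_kernel mode_val bmfun_mode. Qed.

Lemma test_sym x y : test_kernel x y = test_kernel y x.
Proof. exact: rank_kernel_sym. Qed.

Lemma test_343 : pat_dens P 0 test_kernel (cpc_pat 3 4 3) = 256 * k%:R ^+ 2 * m ^+ 2.
Proof.
rewrite (pat_dens_cpc343 P _ bmfun_test test_sym) test_Top2 phi2; ring.
Qed.

Lemma test_325 : pat_dens P 0 test_kernel (cpc_pat 3 2 5) = - 512 * k%:R ^+ 2 * m.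
Proof.
rewrite (pat_dens_cpc325 P _ bmfun_test test_sym) test_Top2 W4 phi2; ring.
Qed.

Lemma test_55 : pat_dens P 0 test_kernel (cc_pat 5 5) = 1024 * k%:R ^+ 2.
Proof.
rewrite (pat_dens_cc55 P _ bmfun_test test_sym) W4 phi2; ring.
Qed.

Lemma test_is_kernel : is_kernel test_kernel.
Proof.
have [mU [M UM]] := bmfun_test; split.
- by apply: measurable_funTS; exact: mU.
- by exists M => x y _ _; exact: (UM (x, y)).
- by move=> x y _ _; exact: test_sym.
Qed.

End test_kernel.

(** * The expansion of local commonality *)

Section expansion.
Variables (R : realType) (H : sgraph).
Local Notation TR := (measurableTypeR R).
Local Notation P := (lebesgue01 R).
Local Notation I := (`[0, 1]%classic : set R).
Variables U U' : R -> R -> R.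
Hypothesis bU : bmfun (fun p : TR * TR => U' p.1 p.2).
Hypothesis symU : forall x y, U' x y = U' y x.
Hypothesis UU' : forall x y, I x -> I y -> U' x y = U x y.

Let lev k : R := level H P U' k.
Let m := #|edges H|.

Lemma hom_density_levels (c e : R) : hom_density H (fun x y => c + e * U x y) =
  \sum_(k < m.+1) c ^+ (m - k) * e ^+ k * lev k.
Proof.
rewrite (hom_density_ExV H c e bU symU UU') (ExV_expand (P : probability TR R) bU).
rewrite (partition_big (fun F : {set {set H}} => inord #|F| : 'I_m.+1) xpredT)//=.
apply: eq_bigr => k _; rewrite /lev /level mulr_sumr.
apply: eq_big => [F|F /andP[FE /eqP Fk]].
  case: (boolP (F \subset _)) => //= FE.
  by rewrite -val_eqE /= inordK// ltnS subset_leq_card.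
by rewrite -Fk inordK// ltnS subset_leq_card.
Qed.

Let q k : R := 2^-1 ^+ (m - k) * (1 + (-1) ^+ k) * lev k * (0 < k)%N%:R.

(** The odd powers cancel and the constant terms drop out. *)
Lemma commonality_gap e :
  hom_density H (fun x y => 2^-1 + e * U x y) +
  hom_density H (fun x y => 2^-1 - e * U x y) -
  2 * hom_density H (fun _ _ => 2^-1) = \sum_(k < m.+1) q k * e ^+ k.
Proof.
have -> : (fun x y => 2^-1 - e * U x y) = (fun x y => 2^-1 + (- e) * U x y).
  by apply/funext => x; apply/funext => y; rewrite mulNr.
have -> : (fun _ _ : R => 2^-1 : R) = (fun x y => 2^-1 + 0 * U x y).
  by apply/funext => x; apply/funext => y; rewrite mul0r addr0.
rewrite !hom_density_levels mulr_sumr -big_split/= -sumrB; apply: eq_bigr => k _.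
rewrite /q [(- e) ^+ k]exprNn expr0n; move: (2^-1 ^+ _) (lev _) => a l.
case: posnP => [->|k0]; rewrite ?expr0 /=; first by ring.
by move: (e ^+ k) ((-1) ^+ k) => b s; ring.
Qed.

Lemma level_big k : (m < k)%N -> lev k = 0.
Proof.
move=> mk; apply: big_pred0 => F; apply/negP => /andP[/subset_leq_card FE /eqP Fk].
by move: mk; rewrite -Fk ltnNge FE.
Qed.

Let q_sign k : (0 < k)%N -> ~~ odd k -> q k = 2 * 2^-1 ^+ (m - k) * lev k.
Proof.
move=> k0 ek; rewrite /q k0 -signr_odd (negPf ek) expr0.
by move: (2^-1 ^+ _) (lev _) => a l /=; ring.
Qed.

Let q_low k : (forall j, (0 < j < k)%N -> ~~ odd j -> lev j = 0) ->
  forall j, (j < k)%N -> q j = 0.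
Proof.
move=> low j jk; rewrite /q; case: (posnP j) => [->|j0]; first by rewrite mulr0.
rewrite -signr_odd; have [oj|ej] := boolP (odd j); first by rewrite expr1 subrr mulr0 !mul0r.
by rewrite low ?j0// mulr0 mul0r.
Qed.

Lemma lowest_level k : (0 < k)%N -> ~~ odd k ->
  (forall j, (0 < j < k)%N -> ~~ odd j -> lev j = 0) -> lev k != 0 ->
  exists2 e0 : R, 0 < e0 & forall e, 0 < e < e0 ->
    0 < lev k * (hom_density H (fun x y => 2^-1 + e * U x y) +
      hom_density H (fun x y => 2^-1 - e * U x y) -
      2 * hom_density H (fun _ _ => 2^-1)).
Proof.
move=> k0 ek low levk.
have km : (k < m.+1)%N.
  by rewrite ltnS leqNgt; apply: contraNN levk => mk; rewrite level_big.
have qk : 0 < lev k * q k.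
  rewrite q_sign// mulrCA -expr2 pmulr_rgt0; first by rewrite exprn_even_gt0.
  by rewrite mulr_gt0// exprn_gt0// invr_gt0.
have [|e0 e00 He] := leading_term (q := fun j => lev k * q j) km _ qk.
  by move=> j jk; rewrite (q_low low jk) mulr0.
exists e0 => // e /He; rewrite commonality_gap mulr_sumr.
by under eq_bigr do rewrite -mulrA.
Qed.

Lemma locally_common_no_level : (forall j, (0 < j)%N -> ~~ odd j -> lev j = 0) ->
  forall e, hom_density H (fun x y => 2^-1 + e * U x y) +
      hom_density H (fun x y => 2^-1 - e * U x y) =
      2 * hom_density H (fun _ _ => 2^-1).
Proof.
move=> low e; apply/eqP; rewrite -subr_eq0 commonality_gap; apply/eqP.
apply: big1 => k _; rewrite (q_low (k := k.+1))// ?mul0r// => j /andP[j0 _].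
exact: low.
Qed.

End expansion.

Lemma level_null (R : realType) (H : sgraph) d (T : measurableType d)
  (P : probability T R) (x0 : T) (U : T -> T -> R) j :
  bmfun (fun p : T * T => U p.1 p.2) -> (forall x y, U x y = U y x) ->
  (forall f, bmfun f -> inner P (Top P U f) (Top P U f) = 0) ->
  (0 < j)%N -> level H P U j = 0.
Proof.
move=> bU symU null j0; apply: big1 => F /andP[/fintype.subsetP FE /eqP Fj].
apply: (dens_null x0 bU symU _ null) => [A /FE|]; first exact: edges_pair.
by rewrite -card_gt0 Fj.
Qed.

(** Geometric mean against arithmetic mean, and Cauchy-Schwarz for [b]. *)
Lemma quadratic_form_ge0 (R : realFieldType) (s33 s35 s55 : nat) (a b c : R) :
  (s35 ^ 2 <= 4 * s33 * s55)%N -> 0 <= a -> 0 <= c -> b ^+ 2 <= a * c ->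
  0 <= s33%:R * a + s35%:R * b + s55%:R * c.
Proof.
rewrite -(ler_nat R) natrX !natrM => s a0 c0 bac.
have x0 : 0 <= s33%:R * a by rewrite mulr_ge0.
have y0 : 0 <= s55%:R * c by rewrite mulr_ge0.
suff : `|s35%:R * b| <= s33%:R * a + s55%:R * c.
  by rewrite ler_norml => /andP[h _]; rewrite addrAC -lerBlDl sub0r.
rewrite -[leRHS]ger0_norm ?addr_ge0// -ler_sqr ?nnegrE//.
rewrite !real_normK ?num_real//.
apply: (@le_trans _ _ (4 * (s33%:R * a) * (s55%:R * c))).
  rewrite exprMn (le_trans (ler_wpM2l (sqr_ge0 _) bac))//.
  rewrite (_ : 4 * (s33%:R * a) * (s55%:R * c) = 4 * s33%:R * s55%:R * (a * c)).
    by rewrite ler_wpM2r// mulr_ge0.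
  by ring.
rewrite -subr_ge0 (_ : _ - _ = (s33%:R * a - s55%:R * c) ^+ 2) ?sqr_ge0//.
by ring.
Qed.

(** * Locally common graphs *)

Section main.
Variables (R : realType) (H : sgraph).
Hypotheses (noC4 : ~ contains H (cycle_graph 4))
  (noC6 : ~ contains H (cycle_graph 6))
  (noC8 : ~ contains H (cycle_graph 8))
  (noC3C3 : ~ contains H (cycle_cycle 3 3))
  (noC3C5 : ~ contains H (cycle_cycle 3 5))
  (noC3C7 : ~ contains H (cycle_cycle 3 7))
  (noC3P2C3 : ~ contains H (cycle_path_cycle 3 2 3))
  (twoC3 : contains_two_edge_disjoint H (cycle_graph 3))
  (hasC10 : contains H (cycle_graph 10)).
Implicit Types F : {set {set H}}.
Local Notation E := (edges H).
Local Notation P := (lebesgue01 R).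
Local Notation TR := (measurableTypeR R).

Lemma avoids_excluded F Q : F \subset E -> Q \in even_cycles ++ excluded ->
  avoided F Q.
Proof.
move=> FE; rewrite !inE.
case/or4P => [/eqP->|/eqP->|/eqP->|/or4P[] /eqP->].
- exact: (avoided_copies (labelled_cycle 1)).
- exact: (avoided_copies (labelled_cycle 3)).
- exact: (avoided_copies (labelled_cycle 5)).
- exact: (avoided_copies (labelled_cc 0 0)).
- exact: (avoided_copies (labelled_cc 0 2)).
- exact: (avoided_copies (labelled_cc 0 4)).
- exact: (avoided_copies (labelled_cpc 0 1 0)).
Qed.

(** Edge sets of the same shape have the same density for every kernel, and the
test kernel gives different densities to the four shapes. *)
Lemma disjoint_shapes (V : finType) (F : {set {set V}}) Q Q' :
  Q \in [:: cpc_pat 3 4 3; cpc_pat 3 2 5; cc_pat 5 5; cycle_pat 10] ->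
  Q' \in [:: cpc_pat 3 4 3; cpc_pat 3 2 5; cc_pat 5 5; cycle_pat 10] ->
  has_shape F Q -> has_shape F Q' -> Q = Q'.
Proof.
pose U := @test_kernel R 1 1; pose v Q := pat_dens P 0 U Q.
have bU := bmfun_test 1 (1 : R); have symU := @test_sym R 1 1.
have v343 : v (cpc_pat 3 4 3) = 256 by rewrite /v test_343//; ring.
have v325 : v (cpc_pat 3 2 5) = - 512 by rewrite /v test_325//; ring.
have v55 : v (cc_pat 5 5) = 1024 by rewrite /v test_55//; ring.
have v10 : v (cycle_pat 10) = 2082.
  by rewrite /v (pat_dens_C10 _ _ bU symU) test_C10//; ring.
have dv G : G \in [:: cpc_pat 3 4 3; cpc_pat 3 2 5; cc_pat 5 5; cycle_pat 10] ->
    has_shape F G -> @dens R _ TR P U V F = v G.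
  move=> Gin; have /andP[bd sm] : bounded G.1 G.2 && simple G.2.
    by move: Gin; rewrite !inE => /or4P[] /eqP ->.
  exact: dens_shape.
move=> Qin Q'in sQ sQ'; have : v Q = v Q' by rewrite -(dv Q)// -(dv Q').
have lt1 : v (cpc_pat 3 2 5) < v (cpc_pat 3 4 3).
  by rewrite v325 v343 (lt_trans (y := 0)) ?oppr_lt0 ?ltr0n.
have lt2 : v (cpc_pat 3 4 3) < v (cc_pat 5 5) by rewrite v343 v55 ltr_nat.
have lt3 : v (cc_pat 5 5) < v (cycle_pat 10) by rewrite v55 v10 ltr_nat.
clear v343 v325 v55 v10 dv; clearbody v.
move: Qin Q'in; rewrite !inE => /or4P[] /eqP -> /or4P[] /eqP -> // h; exfalso; lra.
Qed.

Lemma path2_shape : exists2 F : {set {set H}}, F \subset E & has_shape F (path_pat 2).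
Proof.
have [K [_ [Kc _ _]]] := twoC3.
have [KE [e einj eK]] := copies_shape (labelled_cycle 0) isT Kc.
exists [set [set e 0%N; e 1%N]; [set e 1%N; e 2]]%SET.
  apply/fintype.subsetP => A /set2P A01; apply: (fintype.subsetP KE).
  by rewrite eK !inE; case: A01 => ->; rewrite eqxx ?orbT.
by exists e => // A; rewrite !inE.
Qed.

(** Each edge of a triangle meets the other two. *)
Lemma triangle_min_degree (V : finType) (F : {set {set V}}) A v :
  has_shape F (cycle_pat 3) -> A \in F -> v \in A ->
  exists B, [/\ B \in F, B != A & v \in B].
Proof.
move=> [e einj eF].
have ne i j : (i < 3)%N -> (j < 3)%N -> i != j -> e i != e j.
  by move=> i3 j3; apply: contraNneq => /einj ->.
have e01 := ne 0%N 1%N isT isT isT; have e12 := ne 1%N 2 isT isT isT.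
have e02 := ne 0%N 2 isT isT isT.
have other (x y z : V) : x != z -> y != z -> [set y; z]%SET != [set x; y]%SET.
  move=> xz yz; apply/eqP => /setP/(_ z).
  by rewrite !inE eqxx orbT ![z == _]eq_sym (negPf xz) (negPf yz).
have F01 : [set e 0%N; e 1%N]%SET \in F by rewrite eF !inE eqxx.
have F12 : [set e 1%N; e 2]%SET \in F by rewrite eF !inE eqxx orbT.
have F20 : [set e 2; e 0%N]%SET \in F by rewrite eF !inE eqxx !orbT.
rewrite eF !inE => /or3P[] /eqP ->; rewrite !inE => /orP[] /eqP ->.
- exists [set e 0%N; e 2]%SET; split; rewrite ?set21//; first by rewrite finset.setUC.
  by rewrite [X in _ != X]finset.setUC other// eq_sym.
- by exists [set e 1%N; e 2]%SET; split; rewrite ?set21// other.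
- exists [set e 1%N; e 0%N]%SET; split; rewrite ?set21//; first by rewrite finset.setUC.
  by rewrite [X in _ != X]finset.setUC other// eq_sym.
- exists [set e 2; e 0%N]%SET; split; rewrite ?set21//.
  by rewrite other// eq_sym.
- exists [set e 2; e 1%N]%SET; split; rewrite ?set21//; first by rewrite finset.setUC.
  by rewrite [X in _ != X]finset.setUC other// eq_sym.
- by exists [set e 0%N; e 1%N]%SET; split; rewrite ?set21// other// eq_sym.
Qed.

Lemma triangles_shape : exists2 F : {set {set H}}, F \subset E &
  has_shape F (union_pat (cycle_pat 3) (cycle_pat 3)).
Proof.
have [K1 [K2 [Kc1 Kc2 K12]]] := twoC3.
have [E1 s1] := copies_shape (labelled_cycle 0) isT Kc1.
have [E2 s2] := copies_shape (labelled_cycle 0) isT Kc2.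
pose F := (K1.2 :|: K2.2)%SET.
have FE : F \subset E by rewrite finset.subUset E1 E2.
have F6 : #|F| = 6.
  by rewrite cardsU K12 cards0 subn0 (shape_card _ _ s1)// (shape_card _ _ s2).
exists F => //.
have [| | | | |Q] := @search_sound _ F _ _ (fun Q => @avoids_excluded F Q FE) shapes6.
- by move=> A /(fintype.subsetP FE); exact: edges_pair.
- move=> A v; rewrite inE => /orP[] AK vA.
    have [B [BK BA vB]] := triangle_min_degree s1 AK vA.
    by exists B; rewrite inE BK.
  have [B [BK BA vB]] := triangle_min_degree s2 AK vA.
  by exists B; rewrite inE BK orbT.
- by rewrite -card_gt0 F6.
- by [].
- by rewrite F6 search6.
by rewrite inE => /eqP ->.
Qed.

Lemma decagon_shape : exists2 F : {set {set H}}, F \subset E & has_shape F (cycle_pat 10).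
Proof.
have [K Kc] := hasC10; have [KE s] := copies_shape (labelled_cycle 7) isT Kc.
by exists K.2.
Qed.

Lemma card_shaped (G : sgraph) Q : labelled G Q -> (0 < Q.1)%N ->
  all (fun i => has (adj Q.2 i) (iota 0 Q.1)) (iota 0 Q.1) ->
  #|copies H G| = #|shaped H Q|.
Proof.
move=> GQ Q0 /allP covered; apply: card_copies => // i iQ.
by have := covered i; rewrite mem_iota iQ => /(_ isT)/hasP[j _ ij]; exists j.
Qed.

Section positive.
Hypothesis form : (#|shaped H (cpc_pat 3 2 5)| ^ 2 <=
  4 * #|shaped H (cpc_pat 3 4 3)| * #|shaped H (cc_pat 5 5)|)%N.

(** The lowest level that does not vanish is examined; when each level implies
that a further functional of the kernel is zero, the kernel ends up acting as
zero. *)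
Lemma nonneg_locally_common : locally_common R H.
Proof.
pose o : TR := 0 : R.
move=> U kU; have bU := bmfun_cutoff kU; have symU := cutoff_sym kU.
have UU' x y := @cutoffE R U x y.
set U' := cutoff U in bU symU UU'.
pose lev := level H P U'.
have positive k : (0 < k)%N -> ~~ odd k ->
    (forall j, (0 < j < k)%N -> ~~ odd j -> lev j = 0) -> 0 < lev k ->
    exists2 e0 : R, 0 < e0 & forall e, 0 < e < e0 ->
      2 * hom_density H (fun _ _ => 2^-1) <=
      hom_density H (fun x y => 2^-1 + e * U x y) +
      hom_density H (fun x y => 2^-1 - e * U x y).
  move=> k0 ek low levk.
  have [|e0 e00 He] := lowest_level (H := H) bU symU UU' k0 ek low; first by rewrite gt_eqF.
  by exists e0 => // e /He; rewrite pmulr_rgt0// subr_gt0 => /ltW.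
have step k : (forall j, (0 < j < k)%N -> ~~ odd j -> lev j = 0) -> lev k = 0 ->
    forall j, (0 < j < k.+2)%N -> ~~ odd k -> ~~ odd j -> lev j = 0.
  move=> low levk j /andP[j0]; rewrite ltnS leq_eqVlt => /orP[/eqP->|].
    by move=> /= /negPf ->.
  by rewrite ltnS leq_eqVlt => /orP[/eqP-> //|jk] _; apply: low; rewrite j0.
have low2 j : (0 < j < 2)%N -> ~~ odd j -> lev j = 0 by case: j => [|[|[]]].
pose T1 := inner P (Top P U' (fun=> 1)) (Top P U' (fun=> 1)).
have [T1z|T1n0] := eqVneq T1 0; last first.
  have [F FE Fs] := path2_shape.
  by apply: (positive 2) => //; apply: (level2_gt0 o bU symU FE Fs); rewrite lt_def T1n0 inner_ge0.
have low4 j (j4 : (0 < j < 4)%N) : ~~ odd j -> lev j = 0.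
  apply: (step 2 low2 _ j j4 isT).
  exact: (level2 avoids_excluded o bU symU T1z).
have low6 j (j6 : (0 < j < 6)%N) : ~~ odd j -> lev j = 0.
  apply: (step 4 low4 _ j j6 isT).
  exact: (level4 avoids_excluded o bU symU T1z).
have [C3|C3n0] := eqVneq (cycle_density P U' 2) 0; last first.
  have [F FE Fs] := triangles_shape.
  by apply: (positive 6) => //; apply: (level6_gt0 avoids_excluded o bU symU T1z FE Fs).
have low8 j (j8 : (0 < j < 8)%N) : ~~ odd j -> lev j = 0.
  apply: (step 6 low6 _ j j8 isT).
  exact: (level6 avoids_excluded o bU symU T1z C3).
have low10 j (j10 : (0 < j < 10)%N) : ~~ odd j -> lev j = 0.
  apply: (step 8 low8 _ j j10 isT).
  exact: (level8 avoids_excluded o bU symU T1z C3).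
have C9 : 0 <= cycle_density P U' 9 := cycle_density_ge0 P bU symU 4.
have [C9z|C9n0] := eqVneq (cycle_density P U' 9) 0.
  exists 1 => // e _.
  rewrite (locally_common_no_level (H := H) bU symU UU')// => j j0 _.
  apply: (@level_null R H _ _ P o U' j bU symU _ j0).
  exact: (cycle_density_null bU symU (k := 4)).
apply: (positive 10 isT isT low10).
have [F FE Fs] := decagon_shape.
have rest : cycle_density P U' 9 <= rest10 H P U'.
  exact: (rest10_ge avoids_excluded o bU symU T1z C3 (@disjoint_shapes H) FE Fs).
rewrite /lev (level10 P o bU symU (@disjoint_shapes H)).
apply: ltr_wpDl; last by rewrite (lt_le_trans _ rest)// lt_def C9n0.
rewrite (pat_dens_cpc343 P o bU symU) (pat_dens_cpc325 P o bU symU).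
rewrite (pat_dens_cc55 P o bU symU); set f := iter 2 _ _; set g := closed_walk _ _ 4.
have bg : bmfun g := bmfun_closed_walk P bU 4.
have bf : bmfun f := bmfun_iter P bU 2 (bmfun_closed_walk P bU 2).
apply: (quadratic_form_ge0 form); [exact: inner_ge0|exact: inner_ge0|exact: inner_CS].
Qed.

End positive.

(** A quadratic polynomial with positive discriminant is negative somewhere on
the positive half-line, at its vertex unless it is affine. *)
Lemma negative_point (s33 s35 s55 : nat) : (4 * s33 * s55 < s35 ^ 2)%N ->
  exists2 m : R, 0 <= m & s33%:R * m ^+ 2 - 2 * s35%:R * m + 4 * s55%:R < 0.
Proof.
move=> s; have s35_gt0 : (0 < s35)%N by case: s35 s.
have [z|p] := posnP s33.
  exists (2 * s55%:R + 1); first by rewrite addr_ge0 ?mulr_ge0.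
  have : 1 <= s35%:R :> R by rewrite ler1n.
  have : 0 <= s55%:R :> R by exact: ler0n.
  by rewrite z; nra.
have p0 : 0 < s33%:R :> R by rewrite ltr0n.
exists (s35%:R / s33%:R); first by rewrite divr_ge0.
rewrite (_ : _ + _ = (4 * s33%:R * s55%:R - s35%:R ^+ 2) / s33%:R); last first.
  by field; rewrite gt_eqF.
by rewrite ltr_pdivrMr// mul0r subr_lt0 -!natrM -natrX ltr_nat.
Qed.

(** The form is quadratic in the number of eigenfunctions and the remainder is
linear, so the form prevails. *)
Lemma negative_parameters (s33 s35 s55 M : nat) : (4 * s33 * s55 < s35 ^ 2)%N ->
  exists k (m : R), 0 <= m /\
    s33%:R * (256 * k%:R ^+ 2 * m ^+ 2) + s35%:R * (- 512 * k%:R ^+ 2 * m) +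
    s55%:R * (1024 * k%:R ^+ 2) + M%:R * (2 * m ^+ 5 + 2080 * k%:R) < 0.
Proof.
move=> neg; have [m m0 qm] := negative_point neg.
pose del := - (s33%:R * m ^+ 2 - 2 * s35%:R * m + 4 * s55%:R).
have del0 : 0 < del by rewrite oppr_gt0.
pose X := M%:R * (2 * m ^+ 5 + 2080) / (256 * del).
have [k k1 kX] : exists2 k : nat, 1 <= k%:R :> R & X < k%:R.
  by exists (Num.truncn X).+1; [rewrite ler1n|exact: truncnS_gt].
exists k, m; split; first exact: m0.
have m5 : 0 <= m ^+ 5 by rewrite exprn_ge0.
have M0 : 0 <= M%:R :> R by exact: ler0n.
have d0 : 0 < 256 * del by apply: mulr_gt0; first by rewrite ltr0n.
move: kX; rewrite /X (ltr_pdivrMr _ _ d0); move: (k%:R) k1 => K K1 KM.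
have : M%:R * (2 * m ^+ 5 + 2080 * K) <= K * (M%:R * (2 * m ^+ 5 + 2080)).
  rewrite [leRHS]mulrCA; apply: ler_wpM2l => //.
  rewrite mulrDr [K * 2080]mulrC lerD2r.
  by rewrite ler_peMl// mulr_ge0.
have : K * (M%:R * (2 * m ^+ 5 + 2080)) < K * (K * (256 * del)).
  by rewrite ltr_pM2l// (lt_le_trans _ K1).
move: (M%:R) M0 => MM MM0 lt1 le1.
have -> : s33%:R * (256 * K ^+ 2 * m ^+ 2) + s35%:R * (- 512 * K ^+ 2 * m) +
    s55%:R * (1024 * K ^+ 2) = - (K * (K * (256 * del))) by rewrite /del; ring.
rewrite addrC subr_lt0; exact: le_lt_trans le1 lt1.
Qed.

Lemma level10_test k (m : R) : 0 <= m ->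
  level H P (test_kernel k m) 10 <=
  #|shaped H (cpc_pat 3 4 3)|%:R * (256 * k%:R ^+ 2 * m ^+ 2) +
  #|shaped H (cpc_pat 3 2 5)|%:R * (- 512 * k%:R ^+ 2 * m) +
  #|shaped H (cc_pat 5 5)|%:R * (1024 * k%:R ^+ 2) +
  #|{: {set {set H}}}|%:R * (2 * m ^+ 5 + 2080 * k%:R).
Proof.
pose o : TR := 0 : R.
move=> m0; have bU := bmfun_test k m; have symU := @test_sym R k m.
have C3 : cycle_density P (test_kernel k m) 2 = 0 := test_cycle k m 1.
have C5 : cycle_density P (test_kernel k m) 4 = 0 := test_cycle k m 2.
rewrite (level10 P o bU symU (@disjoint_shapes H)).
rewrite (test_343 k m0) (test_325 k m0) test_55 lerD2l.
have := rest10_le avoids_excluded o bU symU (test_degree k m) C3.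
by rewrite C5 expr0n addr0 (test_C10 k m0).
Qed.

(** For the test kernel the tenth level is the lowest one that counts, and it
is negative for a suitable choice of the parameters. *)
Lemma locally_common_nonneg : locally_common R H ->
  (#|shaped H (cpc_pat 3 2 5)| ^ 2 <=
   4 * #|shaped H (cpc_pat 3 4 3)| * #|shaped H (cc_pat 5 5)|)%N.
Proof.
pose o : TR := 0 : R.
move=> common; rewrite leqNgt; apply/negP => neg.
have [k [m [m0 neg_km]]] := negative_parameters #|{: {set {set H}}}| neg.
have lev10 := le_lt_trans (level10_test k m0) neg_km.
have bU := bmfun_test k m; have symU := @test_sym R k m.
have T1 := test_degree k m.
have C3 : cycle_density P (test_kernel k m) 2 = 0 := test_cycle k m 1.
have low j : (0 < j < 10)%N -> ~~ odd j -> level H P (test_kernel k m) j = 0.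
  case: j => [|[|[|[|[|[|[|[|[|[|]]]]]]]]]] // _ _.
  - exact: (level2 avoids_excluded o bU symU T1).
  - exact: (level4 avoids_excluded o bU symU T1).
  - exact: (level6 avoids_excluded o bU symU T1 C3).
  - exact: (level8 avoids_excluded o bU symU T1 C3).
have [e1 e10 common1] := common _ (test_is_kernel k m).
have [|e2 e20 He] := lowest_level (H := H) bU symU (fun _ _ _ _ => erefl)
  (k := 10) isT isT low; first by rewrite lt_eqF.
pose e := Num.min e1 e2 / 2.
have min0 : 0 < Num.min e1 e2 by rewrite lt_min e10 e20.
have e0 : 0 < e by rewrite divr_gt0.
have : e < Num.min e1 e2 by rewrite ltr_pdivrMr// ltr_pMr// ltr1n.
rewrite lt_min => /andP[ee1 ee2].
have := common1 e; rewrite e0 ee1 => /(_ isT); rewrite -subr_ge0 => h.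
have := He e; rewrite e0 ee2 => /(_ isT).
by rewrite nmulr_rgt0// ltNge h.
Qed.

End main.

Close Scope ring_scope.
Close Scope classical_set_scope.

Theorem mainTheorem6 (R : realType) (H : sgraph)
  (noC4 : ~ contains H (cycle_graph 4))
  (noC6 : ~ contains H (cycle_graph 6))
  (noC8 : ~ contains H (cycle_graph 8))
  (noC3C3 : ~ contains H (cycle_cycle 3 3))
  (noC3C5 : ~ contains H (cycle_cycle 3 5))
  (noC3C7 : ~ contains H (cycle_cycle 3 7))
  (noC3P2C3 : ~ contains H (cycle_path_cycle 3 2 3))
  (twoC3 : contains_two_edge_disjoint H (cycle_graph 3))
  (hasC10 : contains H (cycle_graph 10)) :
  let s33 := #|copies H (cycle_path_cycle 3 4 3)| in
  let s35 := #|copies H (cycle_path_cycle 3 2 5)| in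
  let s55 := #|copies H (cycle_cycle 5 5)| in
  locally_common R H <-> (s35 ^ 2 <= 4 * s33 * s55)%N.
Proof.
move=> s33 s35 s55; rewrite /s33 /s35 /s55.
rewrite (card_shaped H (labelled_cpc 0 3 0))//.
rewrite (card_shaped H (labelled_cpc 0 1 2))//.
rewrite (card_shaped H (labelled_cc 2 2))//.
split; first exact: locally_common_nonneg.
exact: nonneg_locally_common.
Qed.
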